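(* Let $\mathcal C$ be a partial Kepler map having $u_1=\mathrm G_2=\|\mathrm C^{(2)}\|$ among its coordinates, and fix a domain for $\mathcal C$ where $x^{(1)}_{\mathcal C}\times\mathrm C^{(2)}_{\mathcal C}$, $\mathrm C^{(2)}_{\mathcal C}\times\mathrm P^{(2)}_{\mathcal C}$ and $\mathrm C^{(2)}_{\mathcal C}$ never vanish. Let $h:(\Lambda_2,u,v)\in\mathcal A\times V\to h(\Lambda_2,u,v)$ Poisson-commute with $$\mathrm E_0=\mathrm G_2^2-\mathrm m_2^2\mathrm M_2\,\mathrm e_2\,x^{(1)}\cdot\mathrm P^{(2)}.$$ Assume that $h$ has the form $$h=\sum_{n=0}^\infty\sum_{m=0}^\infty h_{nm}(\Lambda_2,u,v)\,\rho^n\cos m\varphi,$$ where $\rho(\Lambda_2,u,v):=\|x^{(1)}_{\mathcal C}\|$ and $\varphi(\Lambda_2,u,v)$ is the angle formed by the two vectors $x^{(1)}_{\mathcal C}\times\mathrm C^{(2)}_{\mathcal C}$ and $\mathrm C^{(2)}_{\mathcal C}\times\mathrm P^{(2)}_{\mathcal C}$, with respect to the counterclockwise orientation established by $\mathrm C^{(2)}_{\mathcal C}$. Assume also that each $h_{nm}$ depends on $(\Lambda_2,u,v)$ only via the quantities $$\Lambda_2,\qquad u_1=\mathrm G_2,\qquad \Theta:=\frac{x^{(1)}_{\mathcal C}\cdot\mathrm C^{(2)}_{\mathcal C}}{\|x^{(1)}_{\mathcal C}\|},$$ with $h_{0m}$ independent of $\mathrm G_2$ for all $m\ge0$. Then $$h_{nm}\equiv0\qquad\text{if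 } m\ge\max\{1,n\},\quad\forall\,n\ge0.$$ In the case that, for $n\ge1$, $h_{nm}=0$ whenever $n-m$ is odd, the following stronger identities hold: $$h_{nm}\equiv0\qquad\text{if } m\ge n-1,\quad\forall\,n\ge1.$$
   Context: Let $(y^{(i)},x^{(i)})\in\mathbb R^3\times\mathbb R^3$, $i=1,2$, be impulse--position coordinates of two particles, and let $\mathrm m_2,\mathrm M_2>0$ be mass parameters. A \emph{partial Kepler map} is a change of coordinates $\mathcal C:(\Lambda_2,\ell_2,u,v)\in\mathcal A\times\mathbb T\times V\to(y^{(1)},y^{(2)},x^{(1)},x^{(2)})\in(\mathbb R^3)^4$, where $\mathcal A\subset\mathbb R$ and $V\subset\mathbb R^{10}$ are domains (open connected sets), $\mathbb T=\mathbb R/(2\pi\mathbb Z)$, $u=(u_1,\dots,u_5)$, $v=(v_1,\dots,v_5)$, which preserves the standard two-form, $$dy^{(1)}\wedge dx^{(1)}+dy^{(2)}\wedge dx^{(2)}=d\Lambda_2\wedge d\ell_2+du\wedge dv,$$ and satisfies $$\Big(\frac{\|y^{(2)}\|^2}{2\mathrm m_2}-\frac{\mathrm m_2\mathrm M_2}{\|x^{(2)}\|}\Big)\circ\mathcal C=-\frac{\mathrm m_2^3\mathrm M_2^2}{2\Lambda_2^2}.$$ The image of $\mathcal C$ is contained in the set where $\frac{\|y^{(2)}\|^2}{2\mathrm m_2}-\frac{\mathrm m_2\mathrm M_2}{\|x^{(2)}\|}<0$, and the instantaneous Keplerian ellipse generated by $(y^{(2)},x^{(2)})$ has non-vanishing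 eccentricity. Notation: $\mathrm C^{(2)}=x^{(2)}\times y^{(2)}$, $\mathrm G_2=\|\mathrm C^{(2)}\|$, $\mathrm e_2=\sqrt{1-\mathrm G_2^2/\Lambda_2^2}$ is the eccentricity of the ellipse, and $\mathrm P^{(2)}$ ($\|\mathrm P^{(2)}\|=1$) is the direction of its perihelion. A subscript $\mathcal C$ denotes composition with $\mathcal C$. Poisson brackets are $\{f,g\}=\sum(\partial_pf\,\partial_qg-\partial_pg\,\partial_qf)$ for conjugate coordinates $(p,q)$. Expansions in powers of $\rho=\|x^{(1)}\|$ are formal expansions: power series in $\rho$ whose coefficients are Fourier series in $\varphi\in\mathbb T$ (with differentiable coefficients $h_{nm}$); Poisson commutation of such a series with $\mathrm E_0$ is understood coefficient by coefficient. *)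

(* Defs.v *)
From HB Require Import structures.
From mathcomp Require Import all_boot all_order all_algebra.
From mathcomp Require Import boolp classical_sets reals topology normedtype.
From mathcomp Require Import derive trigo.
Set Implicit Arguments.
Unset Strict Implicit.
Unset Printing Implicit Defensive.
Import Order.TTheory GRing.Theory Num.Theory.
Import numFieldNormedType.Exports.
Local Open Scope classical_set_scope.
Local Open Scope ring_scope.

Section Vectors.
Context {R : realType}.
Implicit Types u v w : 'rV[R]_3.

Definition dot u v : R := \sum_(i < 3) u 0 i * v 0 i.

(* Euclidean norm; the library's [`|u|] on row vectors is the sup norm. *)
Definition enorm u : R := Num.sqrt (dot u u).

Definition cross u v : 'rV[R]_3 :=
  let c w k := w 0 (inord k : 'I_3) in
  \row_(i < 3) [:: c u 1 * c v 2 - c u 2 * c v 1;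
                   c u 2 * c v 0 - c u 0 * c v 2;
                   c u 0 * c v 1 - c u 1 * c v 0]`_i.

(* Representative in ]-pi, pi] of the angle from [u] to [v], counted
   counterclockwise around [w], for nonzero [u], [v] orthogonal to [w]. *)
Definition oriented_angle w u v : R :=
  let t := acos (dot u v / (enorm u * enorm v)) in
  if 0 <= dot w (cross u v) then t else - t.

End Vectors.

Section Phase.
Context {R : realType}.

(* Points ((y1, y2), (x1, x2)) of (R^3)^4. *)
Definition phase : Type := (('rV[R]_3 * 'rV[R]_3) * ('rV[R]_3 * 'rV[R]_3))%type.

Definition y1 (p : phase) : 'rV[R]_3 := p.1.1.
Definition y2 (p : phase) : 'rV[R]_3 := p.1.2.
Definition x1 (p : phase) : 'rV[R]_3 := p.2.1.
Definition x2 (p : phase) : 'rV[R]_3 := p.2.2.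

(* dy1 /\ dx1 + dy2 /\ dx2 *)
Definition phase_form (p q : phase) : R :=
  (dot (y1 p) (x1 q) - dot (y1 q) (x1 p)) +
  (dot (y2 p) (x2 q) - dot (y2 q) (x2 p)).

Definition kepler_energy (m M : R) (p : phase) : R :=
  enorm (y2 p) ^+ 2 / (2 * m) - m * M / enorm (x2 p).

Definition C2 (p : phase) : 'rV[R]_3 := cross (x2 p) (y2 p).

Definition G2 (p : phase) : R := enorm (C2 p).

Definition ecc (L : R) (p : phase) : R := Num.sqrt (1 - G2 p ^+ 2 / L ^+ 2).

Definition rho (p : phase) : R := enorm (x1 p).

Definition Theta (p : phase) : R := dot (x1 p) (C2 p) / enorm (x1 p).

(* Collisionless solutions of Hamilton's equations for
   |Y|^2 / (2 m) - m M / |X|. *)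
Definition kepler_motion (m M : R) (Y X : R -> 'rV[R]_3) : Prop :=
  forall t : R,
    [/\ X t != 0,
        is_derive t 1 X (m^-1 *: Y t) &
        is_derive t 1 Y (- (m * M / enorm (X t) ^+ 3) *: X t)].

(* [P] is the direction of the perihelion (the point closest to the attracting
   centre) of the Keplerian orbit through the initial datum [(y2 p, x2 p)]. *)
Definition perihelion_direction (m M : R) (p : phase) (P : 'rV[R]_3) : Prop :=
  exists Y X : R -> 'rV[R]_3,
    [/\ kepler_motion m M Y X, Y 0 = y2 p, X 0 = x2 p &
        exists t0 : R, (forall t : R, enorm (X t0) <= enorm (X t)) /\
                       P = (enorm (X t0))^-1 *: X t0].

Definition phi (P : 'rV[R]_3) (p : phase) : R :=
  oriented_angle (C2 p) (cross (x1 p) (C2 p)) (cross (C2 p) P).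

End Phase.
Arguments phase : clear implicits.

Section Coordinates.
Context {R : realType}.

(* Pairs (u, v); R^10 is split as R^5 * R^5. *)
Definition uv : Type := ('rV[R]_5 * 'rV[R]_5)%type.

(* Tuples ((Lambda, l), (u, v)); the angle l is lifted from T to R. *)
Definition coords : Type := ((R * R) * uv)%type.

Definition Lam (z : coords) : R := z.1.1.
Definition ell (z : coords) : R := z.1.2.
Definition Luv (z : coords) : R * uv := (z.1.1, z.2).

(* A * T * V *)
Definition dom (A : set R) (V : set uv) : set coords :=
  [set z | A z.1.1 /\ V z.2].

Definition eLam : coords := ((1, 0), (0, 0)).
Definition eell : coords := ((0, 1), (0, 0)).
Definition eu (i : 'I_5) : coords := ((0, 0), (delta_mx 0 i, 0)).
Definition ev (i : 'I_5) : coords := ((0, 0), (0, delta_mx 0 i)).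

(* dLambda /\ dl + du /\ dv *)
Definition coords_form (a b : coords) : R :=
  (a.1.1 * b.1.2 - b.1.1 * a.1.2) +
  \sum_(i < 5) (a.2.1 0 i * b.2.2 0 i - b.2.1 0 i * a.2.2 0 i).

(* The momenta are (Lambda, u), the positions (l, v). *)
Definition poisson (f g : coords -> R) (z : coords) : R :=
  ('D_eLam f z * 'D_eell g z - 'D_eLam g z * 'D_eell f z) +
  \sum_(i < 5) ('D_(eu i) f z * 'D_(ev i) g z - 'D_(eu i) g z * 'D_(ev i) f z).

End Coordinates.
Arguments uv : clear implicits.
Arguments coords : clear implicits.

Record partial_kepler_map (R : realType) (m M : R) (A : set R) (V : set (uv R))
    (C : coords R -> phase R) : Prop := PartialKeplerMap {
  pk_openA : open A;
  pk_connA : connected A;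
  pk_openV : open V;
  pk_connV : connected V;
  pk_periodic : forall z, dom A V z ->
    C ((Lam z, ell z + 2 * pi), z.2) = C z;
  pk_inj : forall z z', dom A V z -> dom A V z' -> C z = C z' ->
    Luv z = Luv z' /\ exists k : int, ell z' = ell z + k%:~R * (2 * pi);
  pk_diff : forall z, dom A V z -> differentiable C z;
  pk_C1 : forall z (w : coords R), dom A V z ->
    {for z, continuous (fun z' => 'D_w C z')};
  pk_symplectic : forall z (a b : coords R), dom A V z ->
    phase_form ('d C z a) ('d C z b) = coords_form a b;
  pk_energy : forall z, dom A V z ->
    kepler_energy m M (C z) = - (m ^+ 3 * M ^+ 2 / (2 * Lam z ^+ 2));
  pk_bound : forall z, dom A V z -> kepler_energy m M (C z) < 0;
  pk_ecc : forall z, dom A V z -> ecc (Lam z) (C z) != 0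
}.

Section FormalExpansions.
Context {R : realType}.
Variables (C : coords R -> phase R) (P : phase R -> 'rV[R]_3).

Definition E0 (m M : R) (z : coords R) : R :=
  G2 (C z) ^+ 2 - m ^+ 2 * M * ecc (Lam z) (C z) * dot (x1 (C z)) (P (C z)).

Definition rhoC (z : coords R) : R := rho (C z).

Definition phiC (z : coords R) : R := phi (P (C z)) (C z).

Definition partial_sum (h : nat -> nat -> R * uv R -> R) (N : nat)
    (z : coords R) : R :=
  \sum_(n < N) \sum_(k < N) h n k (Luv z) * rhoC z ^+ n * cos (k%:R * phiC z).

(* On [D], [f] is the sum over n, k of
     (a n k * cos (k phi) + b n k * sin (k phi)) * rho ^ n,
   a finite expansion whose coefficients are functions of Lambda, G2, Theta. *)
Definition finite_expansion (D : set (coords R)) (f : coords R -> R)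
    (a b : nat -> nat -> R -> R -> R -> R) : Prop :=
  exists K : nat,
    (forall n k, (K <= maxn n k)%N ->
       forall L G T, a n k L G T = 0 /\ b n k L G T = 0) /\
    (forall z, D z ->
       f z = \sum_(n < K) \sum_(k < K)
         (a n k (Lam z) (G2 (C z)) (Theta (C z)) * cos (k%:R * phiC z) +
          b n k (Lam z) (G2 (C z)) (Theta (C z)) * sin (k%:R * phiC z))
         * rhoC z ^+ n).

(* Coefficientwise vanishing of {sum_(n, k) h n k rho^n cos (k phi), g}: the
   truncations of the series have brackets with [g] admitting finite
   expansions, and each coefficient of the bracket of the whole series, i.e.
   the eventual value of the corresponding coefficient along the truncations,
   is zero. *)
Definition formally_commutes (D : set (coords R))
    (h : nat -> nat -> R * uv R -> R) (g : coords R -> R) : Prop :=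
  exists a b : nat -> nat -> nat -> R -> R -> R -> R,
    (forall N, finite_expansion D (poisson (partial_sum h N) g) (a N) (b N)) /\
    (forall n k, exists N0 : nat, forall N z, (N0 <= N)%N -> D z ->
       a N n k (Lam z) (G2 (C z)) (Theta (C z)) = 0 /\
       b N n k (Lam z) (G2 (C z)) (Theta (C z)) = 0).

End FormalExpansions.

(* Main.v *)
From HB Require Import structures.
Require Import Defs.
From mathcomp Require Import all_boot all_order all_algebra.
From mathcomp Require Import boolp classical_sets functions reals topology normedtype.
From mathcomp Require Import landau derive trigo realfun ring lra.
Import Order.TTheory GRing.Theory Num.Theory.
Import numFieldNormedType.Exports.
Local Open Scope classical_set_scope.
Local Open Scope ring_scope.
Set Implicit Arguments.
Unset Strict Implicit.
Unset Printing Implicit Defensive.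

(** Write x = x2 and y = y2. The vector A = cross y C2 - (m^2 M / |x|) x, where
    C2 = cross x y, is conserved by the Kepler flow. At the perihelion it is a
    nonnegative multiple of the position, because there the square of the
    distance is minimal and so has a nonnegative second derivative; hence
    A = m^2 M ecc P everywhere ([lrl_perihelion], [Lrl_perihelion]), and
    E0 = G^2 - B with B = x1 . A a function on phase space that no longer
    mentions P.

    The map C preserves the two-form, so brackets can be computed on phase space,
    where the fields of G and B are explicit. Minus the field of G is the unit
    rotation of (x, y) about C2. Since G is the coordinate u_1, it is also the
    coordinate direction v_1; it fixes Lambda, G, Theta and rho and advances phi
    at unit speed. The field of B fixes Lambda, Theta and rho, and moves G at the
    rate S = x1 . (cross C2 A) / G. As cos phi = - B tau / rho and
    sin phi = S tau / rho with tau a function of (Lambda, G, Theta) only, the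
    bracket of h_nk rho^n cos (k phi) with E0 is the sum of
      2 G k h_nk rho^n sin (k phi),
      - (d h_nk / dG) tau^-1 rho^(n+1) sin phi cos (k phi) and
      - k h_nk omega rho^(n+1) cos phi sin (k phi),
    where omega depends on (Lambda, G, Theta) only ([has_diff_term]).

    The coefficient of rho^j sin (q phi) in the bracket of the series is therefore
    2 G q h_jq plus contributions of the h_(j-1)k with k = q - 1 or q + 1.
    If q >= max (1, j), all of these vanish by induction on j, except that for
    j = 1 the function h_00 may be nonzero; but that one does not depend on G
    and comes with k = 0 ([has_coef_term]). So h_jq = 0. The second assertion
    follows at once: the only new case is m = n - 1, where n - m is odd.

    Two points need care. First, the functions of (Lambda, G, Theta) in the
    hypotheses are arbitrary, so their derivatives have to be produced: along
    a vector w that fixes Lambda and Theta to first order there are points at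
    distance o(t) from z + t w where Lambda and Theta have exactly their values at
    z, by the intermediate value theorem ([level_set_approx]), and this gives the
    derivative in G ([slice_derive_G]). Second, reading off coefficients
    needs enough points on a leaf, that is, a set of points of the domain with
    common values of Lambda, G and Theta. The same lemma shows that functions
    constant on a leaf have zero derivative along the directions tangent to it,
    and two such directions are enough. Along v_1 an expansion that vanishes on
    the leaf can be differentiated in phi, which separates the frequencies
    ([leaf_rotation], [trig_poly_uniq]); along the dilation of x1 a polynomial in
    rho that vanishes on the leaf can be differentiated in rho, so it is zero
    ([leaf_rho_poly]). *)

(** * Differentials of real-valued functions *)

Section HasDiff.
Context {R : realType} {V : normedModType R}.
Implicit Types (f g : V -> R) (z : V) (l : V -> R).

(** Keeping the differential as an explicit function lets calculus rules be
    chained without rewriting under ['d]. *)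
Definition has_diff f z l := differentiable f z /\ forall w, 'd f z w = l w.

Lemma has_diff_eq f z l k : has_diff f z l -> l =1 k -> has_diff f z k.
Proof. by move=> h /funext <-. Qed.

Lemma has_diff_unique f z l k : has_diff f z l -> has_diff f z k -> l =1 k.
Proof. by move=> [_ h1] [_ h2] w; rewrite -h1 -h2. Qed.

Lemma has_diff_linear f z l a b u v : has_diff f z l ->
  l (a *: u + b *: v) = a * l u + b * l v.
Proof. by move=> [_ fl]; rewrite -!fl linearD; congr (_ + _); exact: linearZ. Qed.

Lemma has_diffD f g z l k : has_diff f z l -> has_diff g z k ->
  has_diff (fun x => f x + g x) z (fun w => l w + k w).
Proof.
by move=> [df fl] [dg gk]; split=> [|w];
  [exact: differentiableD|rewrite (diffD df dg) /= fl gk].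
Qed.

Lemma has_diffB f g z l k : has_diff f z l -> has_diff g z k ->
  has_diff (fun x => f x - g x) z (fun w => l w - k w).
Proof.
by move=> [df fl] [dg gk]; split=> [|w];
  [exact: differentiableB|rewrite -fl -gk; have /(congr1 (@^~ w)) := diffB df dg].
Qed.

Lemma has_diffN f z l : has_diff f z l ->
  has_diff (fun x => - f x) z (fun w => - l w).
Proof.
by move=> [df fl]; split=> [|w];
  [exact: differentiableN|rewrite -fl; have /(congr1 (@^~ w)) := diffN df].
Qed.

Lemma has_diffM f g z l k : has_diff f z l -> has_diff g z k ->
  has_diff (fun x => f x * g x) z (fun w => f z * k w + g z * l w).
Proof.
by move=> [df fl] [dg gk]; split=> [|w];
  [exact: differentiableM|rewrite -fl -gk; have /(congr1 (@^~ w)) := diffM df dg].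
Qed.

Lemma has_diff_cst (a : R) z : has_diff (fun=> a) z (fun=> 0).
Proof. by split=> [|w]; [exact: differentiable_cst|rewrite diff_cst]. Qed.

Lemma has_diffZ a f z l : has_diff f z l ->
  has_diff (fun x => a * f x) z (fun w => a * l w).
Proof.
move=> fl; have [d e] := has_diffM (has_diff_cst a z) fl.
by split=> // w; rewrite e mulr0 addr0.
Qed.

Lemma has_diff_sum n (f : 'I_n -> V -> R) z (l : 'I_n -> V -> R) :
  (forall i, has_diff (f i) z (l i)) ->
  has_diff (fun x => \sum_(i < n) f i x) z (fun w => \sum_(i < n) l i w).
Proof.
elim: n f l => [|n IH] f l h.
  under eq_fun do rewrite big_ord0; under [X in has_diff _ _ X]eq_fun do rewrite big_ord0.
  exact: has_diff_cst.
under eq_fun do rewrite big_ord_recr; under [X in has_diff _ _ X]eq_fun do rewrite big_ord_recr.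
by apply: has_diffD => //; apply: IH.
Qed.

Lemma has_diff_comp (g : R -> R) a f z l : is_derive (f z) 1 g a ->
  has_diff f z l -> has_diff (fun x => g (f x)) z (fun w => a * l w).
Proof.
move=> [dg ga] [df fl].
have dg' : differentiable g (f z) by apply/derivable1_diffP.
split=> [|w]; first exact: (differentiable_comp (g := g) df dg').
by rewrite (diff_comp (g := g) df dg') /= fl deriv1E //= derive1E ga /GRing.scale /= mulrC.
Qed.

Lemma has_diffV f z l : f z != 0 -> has_diff f z l ->
  has_diff (fun x => (f x)^-1) z (fun w => - (l w / f z ^+ 2)).
Proof.
move=> f0 fl.
have dV : is_derive (f z) 1 (fun y : R => y^-1) (- (f z) ^- 2).
  by have := is_deriveV f0 (is_derive_id (f z) 1); rewrite /GRing.scale /= mulr1.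
have [d e] := has_diff_comp dV fl; split=> // w.
by rewrite e mulNr mulrC.
Qed.

Lemma has_diff_sqrt f z l : 0 < f z -> has_diff f z l ->
  has_diff (fun x => Num.sqrt (f x)) z (fun w => l w / (2 * Num.sqrt (f z))).
Proof.
move=> f0 fl; have [d e] := has_diff_comp (is_derive1_sqrt f0) fl.
by split=> // w; rewrite e mulrC.
Qed.

Lemma has_diffX f n z l : has_diff f z l ->
  has_diff (fun x => f x ^+ n) z (fun w => n%:R * f z ^+ n.-1 * l w).
Proof.
move=> fl; elim: n => [|n [d e]].
  by have [d e] := has_diff_cst 1 z; split=> // w; rewrite e !mul0r.
have [d' e'] := has_diffM fl (conj d e).
split=> [|w]; first by under eq_fun do rewrite exprS.
under eq_fun do rewrite exprS; rewrite e' /= -[n.+1]addn1 natrD.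
by case: n {d e d' e'} => [|n] /=; rewrite ?exprS; ring.
Qed.

Lemma has_diff_near f g z l : (\near z, f z = g z) ->
  has_diff f z l -> has_diff g z l.
Proof.
move=> fg [df fl]; have fgz := nbhs_singleton fg.
have [lc lo] := (diff_locallyP z f).1 df.
have E : g \o shift z = cst (g z) + 'd f z +o_ 0 id.
  apply/eqaddoP => e e0; move/eqaddoP : lo => /(_ e e0) lo.
  near=> h.
  have -> : (g \o shift z - (cst (g z) + 'd f z)) h =
            (f \o shift z - (cst (f z) + 'd f z)) h.
    rewrite /= !fctE /= fgz; congr (_ - _).
    symmetry; near: h; move: fg; rewrite (near_shift 0 z) subr0; exact.
  by near: h.
have dfg := diff_unique lc E.
split=> [|w]; last by rewrite dfg.
by apply/diff_locallyP; rewrite dfg; split.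
Unshelve. all: by end_near. Qed.

End HasDiff.

Section LinearImages.
Context {R : realType} {V W W' : normedModType R}.

Lemma diff_comp_lin (u : V -> W) (L : {linear W -> W'}) z :
  continuous L -> differentiable u z ->
  differentiable (fun x => L (u x)) z /\
  forall w, 'd (fun x => L (u x)) z w = L ('d u z w).
Proof.
move=> cL du; have dL := @linear_differentiable _ _ _ L (u z) cL.
split=> [|w]; first exact: (differentiable_comp (g := L) du dL).
by rewrite (diff_comp (g := L) du dL) /= (diff_lin _ cL).
Qed.

End LinearImages.

Section Components.
Context {R : realType} {V A B : normedModType R}.

Lemma diff_fst (u : V -> A * B) z : differentiable u z ->
  differentiable (fun x => (u x).1) z /\
  forall w, 'd (fun x => (u x).1) z w = ('d u z w).1.
Proof.
pose c (N : A * B) : A := N.1; have cl : linear c by [].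
pose cM := GRing.isLinear.Build _ _ _ _ _ cl.
pose cL : {linear (A * B)%type -> A} := HB.pack c cM.
by apply: (diff_comp_lin (L := cL)) => p; exact: cvg_fst.
Qed.

Lemma diff_snd (u : V -> A * B) z : differentiable u z ->
  differentiable (fun x => (u x).2) z /\
  forall w, 'd (fun x => (u x).2) z w = ('d u z w).2.
Proof.
pose c (N : A * B) : B := N.2; have cl : linear c by [].
pose cM := GRing.isLinear.Build _ _ _ _ _ cl.
pose cL : {linear (A * B)%type -> B} := HB.pack c cM.
by apply: (diff_comp_lin (L := cL)) => p; exact: cvg_snd.
Qed.

Lemma has_diff_entry n (u : V -> 'rV[R]_n) z i : differentiable u z ->
  has_diff (fun x => u x 0 i) z (fun w => 'd u z w 0 i).
Proof.
pose c (N : 'rV[R]_n) : R := N 0 i.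
have cl : linear c by move=> a N M; rewrite /c !mxE.
pose cM := GRing.isLinear.Build _ _ _ _ _ cl.
pose cL : {linear 'rV[R]_n -> R} := HB.pack c cM.
by apply: (diff_comp_lin (L := cL)); exact: coord_continuous.
Qed.

End Components.

(** * Vectors of R^3 *)

Section VectorAlgebra.
Context {R : realType}.
Implicit Types u v w : 'rV[R]_3.

Lemma eq_row3 u v :
  u 0 (inord 0) = v 0 (inord 0) -> u 0 (inord 1) = v 0 (inord 1) ->
  u 0 (inord 2) = v 0 (inord 2) -> u = v.
Proof.
move=> h0 h1 h2; apply/rowP => i; rewrite -(inord_val i).
by case: i => [[|[|[|]]]].
Qed.

Lemma dotE u v : dot u v = u 0 (inord 0) * v 0 (inord 0) +
  u 0 (inord 1) * v 0 (inord 1) + u 0 (inord 2) * v 0 (inord 2).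
Proof.
rewrite /dot !big_ord_recr big_ord0 /= add0r.
by do ![congr (_ + _)]; congr (_ * _); congr (_ _ _); apply: val_inj; rewrite /= inordK.
Qed.

Lemma cross0E u v : cross u v 0 (inord 0) =
  u 0 (inord 1) * v 0 (inord 2) - u 0 (inord 2) * v 0 (inord 1).
Proof. by rewrite mxE inordK. Qed.

Lemma cross1E u v : cross u v 0 (inord 1) =
  u 0 (inord 2) * v 0 (inord 0) - u 0 (inord 0) * v 0 (inord 2).
Proof. by rewrite mxE inordK. Qed.

Lemma cross2E u v : cross u v 0 (inord 2) =
  u 0 (inord 0) * v 0 (inord 1) - u 0 (inord 1) * v 0 (inord 0).
Proof. by rewrite mxE inordK. Qed.

Definition vecE := (dotE, cross0E, cross1E, cross2E).

Local Ltac coord := rewrite ?(vecE, mxE).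

Lemma dotC u v : dot u v = dot v u.
Proof. by coord; ring. Qed.

Lemma dot0v u : dot 0 u = 0.
Proof. by coord; ring. Qed.

Lemma dotZl a u v : dot (a *: u) v = a * dot u v.
Proof. by coord; ring. Qed.

Lemma dotZr a u v : dot u (a *: v) = a * dot u v.
Proof. by coord; ring. Qed.

Lemma dot_ge0 u : 0 <= dot u u.
Proof. by rewrite dotE; apply: addr_ge0; [apply: addr_ge0|]; rewrite -expr2 sqr_ge0. Qed.

Lemma dot_eq0 u : (dot u u == 0) = (u == 0).
Proof.
apply/eqP/eqP => [|->]; last exact: dot0v.
rewrite dotE => h.
have [a b c] : [/\ u 0 (inord 0) = 0, u 0 (inord 1) = 0 & u 0 (inord 2) = 0].
  by split; nra.
by apply: eq_row3; rewrite mxE.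
Qed.

Lemma enorm_sqr u : enorm u ^+ 2 = dot u u.
Proof. by rewrite sqr_sqrtr ?dot_ge0. Qed.

Lemma enorm_gt0 u : (0 < enorm u) = (u != 0).
Proof. by rewrite sqrtr_gt0 lt_neqAle dot_ge0 andbT eq_sym dot_eq0. Qed.

Lemma enorm_ge0 u : 0 <= enorm u.
Proof. exact: sqrtr_ge0. Qed.

Lemma enormZ a u : enorm (a *: u) = `|a| * enorm u.
Proof. by rewrite /enorm dotZl dotZr mulrA -expr2 sqrtrM ?sqr_ge0// sqrtr_sqr. Qed.

Lemma dot_cross_cross u v : dot (cross u v) (cross u v) =
  dot u u * dot v v - dot u v ^+ 2.
Proof. by coord; ring. Qed.

Lemma cross0v u : cross 0 u = 0.
Proof. by apply: eq_row3; coord; ring. Qed.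

Lemma crossv0 u : cross u 0 = 0.
Proof. by apply: eq_row3; coord; ring. Qed.

Lemma crossZr a u v : cross u (a *: v) = a *: cross u v.
Proof. by apply: eq_row3; coord; ring. Qed.

Lemma double_cross u v w : cross u (cross v w) = dot u w *: v - dot u v *: w.
Proof. by apply: eq_row3; coord; ring. Qed.

Lemma cos_oriented_angle w u v : u != 0 -> v != 0 ->
  cos (oriented_angle w u v) = dot u v / (enorm u * enorm v).
Proof.
move=> u0 v0; rewrite /oriented_angle.
have nu : 0 < enorm u by rewrite enorm_gt0.
have nv : 0 < enorm v by rewrite enorm_gt0.
have sq : dot u v ^+ 2 <= (enorm u * enorm v) ^+ 2.
  by rewrite exprMn !enorm_sqr -subr_ge0 -dot_cross_cross dot_ge0.
have b : `|dot u v / (enorm u * enorm v)| <= 1.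
  rewrite normrM normfV ler_pdivrMr ?mul1r; last by rewrite normr_gt0 gt_eqF// mulr_gt0.
  by rewrite -(@ler_pXn2r _ 2) ?nnegrE // !real_normK ?num_real.
have e : cos (acos (dot u v / (enorm u * enorm v))) = dot u v / (enorm u * enorm v).
  by rewrite acosK // in_itv /=; move: b; rewrite ler_norml.
by case: ifP => _; rewrite ?cosN.
Qed.

(** The squares agree by the identity of Lagrange, since cross u v is parallel to w;
    the signs agree by the choice of the sign of the angle. *)
Lemma sin_oriented_angle w u v : u != 0 -> v != 0 -> w != 0 ->
  dot w u = 0 -> dot w v = 0 ->
  sin (oriented_angle w u v) =
  dot w (cross u v) / (enorm w * enorm u * enorm v).
Proof.
move=> u0 v0 w0 wu wv.
have nu : 0 < enorm u by rewrite enorm_gt0.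
have nv : 0 < enorm v by rewrite enorm_gt0.
have nw : 0 < enorm w by rewrite enorm_gt0.
set t := oriented_angle w u v; set d := dot w (cross u v).
have sq : sin t ^+ 2 = (d / (enorm w * enorm u * enorm v)) ^+ 2.
  rewrite sin2cos2 cos_oriented_angle // !exprMn !exprVn !exprMn.
  have -> : d ^+ 2 = enorm w ^+ 2 * (enorm u ^+ 2 * enorm v ^+ 2 - dot u v ^+ 2).
    rewrite !enorm_sqr -dot_cross_cross.
    have := dot_cross_cross w (cross u v).
    have -> : cross w (cross u v) = 0 by rewrite double_cross wu wv !scale0r subrr.
    by rewrite dot0v -/d => /eqP; rewrite eq_sym subr_eq0 => /eqP ->.
  by field; rewrite !gt_eqF.
have sg : (0 <= d) = (0 <= d / (enorm w * enorm u * enorm v)).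
  by rewrite pmulr_lge0 // invr_gt0 !mulr_gt0.
have st : if 0 <= d then 0 <= sin t else sin t <= 0.
  have b : -1 <= dot u v / (enorm u * enorm v) <= 1.
    by rewrite -(@cos_oriented_angle w) // cos_geN1 cos_le1.
  have a0 := acos_ge0 b; have api := acos_lepi b.
  have h := sin_ge0_pi (introT andP (conj a0 api)).
  by rewrite /t /oriented_angle -/d; case: (0 <= d); rewrite // sinN oppr_le0.
have /eqP := sq; rewrite eqf_sqr => /orP[/eqP//|/eqP E].
move: st; rewrite sg E; case: ifP; set q := (d / _) => h st.
  by lra.
by move: st; rewrite oppr_le0 h.
Qed.

End VectorAlgebra.

Ltac coord := rewrite ?(vecE, mxE).

Section VectorDiff.
Context {R : realType} {V : normedModType R}.
Implicit Types (u v : V -> 'rV[R]_3) (z : V) (du dv : V -> 'rV[R]_3).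

Definition has_diffv u z du :=
  forall i, has_diff (fun x => u x 0 i) z (fun w => du w 0 i).

Lemma has_diff_dot u v z du dv : has_diffv u z du -> has_diffv v z dv ->
  has_diff (fun x => dot (u x) (v x)) z (fun w => dot (du w) (v z) + dot (u z) (dv w)).
Proof.
move=> hu hv; apply: has_diff_eq.
  by apply: has_diff_sum => i; apply: has_diffM; [apply: hu|apply: hv].
by move=> w /=; rewrite /dot -big_split /=; apply: eq_bigr => i _; ring.
Qed.

Lemma has_diffv_cross u v z du dv : has_diffv u z du -> has_diffv v z dv ->
  has_diffv (fun x => cross (u x) (v x)) z
            (fun w => cross (du w) (v z) + cross (u z) (dv w)).
Proof.
move=> hu hv i; rewrite -(inord_val i).
case: i => [[|[|[|]]]] //= _.
- under eq_fun do rewrite cross0E.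
  apply: has_diff_eq; first by apply: has_diffB; apply: has_diffM; (exact: hu || exact: hv).
  by move=> w /=; coord; ring.
- under eq_fun do rewrite cross1E.
  apply: has_diff_eq; first by apply: has_diffB; apply: has_diffM; (exact: hu || exact: hv).
  by move=> w /=; coord; ring.
- under eq_fun do rewrite cross2E.
  apply: has_diff_eq; first by apply: has_diffB; apply: has_diffM; (exact: hu || exact: hv).
  by move=> w /=; coord; ring.
Qed.

Lemma has_diffvB u v z du dv : has_diffv u z du -> has_diffv v z dv ->
  has_diffv (fun x => u x - v x) z (fun w => du w - dv w).
Proof.
move=> hu hv i; under eq_fun do rewrite !mxE.
by apply: has_diff_eq; [apply: has_diffB; [exact: hu|exact: hv]|move=> w /=; rewrite !mxE].
Qed.

Lemma has_diffvZ (f : V -> R) l u z du : has_diff f z l -> has_diffv u z du ->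
  has_diffv (fun x => f x *: u x) z (fun w => l w *: u z + f z *: du w).
Proof.
move=> hf hu i; under eq_fun do rewrite !mxE.
apply: has_diff_eq; first by apply: has_diffM; [exact: hf|exact: hu].
by move=> w /=; rewrite !mxE; ring.
Qed.

Lemma has_diff_enorm u z du : u z != 0 -> has_diffv u z du ->
  has_diff (fun x => enorm (u x)) z (fun w => dot (u z) (du w) / enorm (u z)).
Proof.
move=> u0 hu; have n0 : 0 < enorm (u z) by rewrite enorm_gt0.
apply: has_diff_eq.
  apply: has_diff_sqrt (has_diff_dot hu hu).
  by rewrite -enorm_sqr exprn_gt0.
move=> w /=; rewrite -/(enorm _) (dotC (du w)); field; exact: lt0r_neq0.
Qed.

End VectorDiff.

(** * The Keplerian ellipse and its perihelion *)

Section OneVariable.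
Context {R : realType}.

(** If d < 0, then q would be negative just after t0, so f would decrease there
    by the mean value theorem. *)
Lemma second_order_min (f q : R -> R) (d t0 : R) :
  (forall t : R, is_derive t 1 f (q t)) -> (forall t, f t0 <= f t) ->
  is_derive t0 1 q d -> q t0 = 0 /\ 0 <= d.
Proof.
move=> df fmin [dq qd].
have q0 : q t0 = 0.
  have h : is_derive t0 1 f 0.
    apply: (@derive1_at_min _ f (t0 - 1) (t0 + 1)).
    - by lra.
    - by move=> t _; have [] := df t.
    - by rewrite in_itv /=; lra.
    - by move=> t _.
  by have [_ <-] := df t0; have [_ ->] := h.
split=> //; rewrite leNgt; apply/negP => d0.
have : \forall h \near 0^', h^-1 *: (q (h *: 1 + t0) - q t0) < 0.
  by apply: (cvgr_lt d) => //; rewrite -qd; exact: dq.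
rewrite q0 => /nbhs_ballP[e /= e0 he].
have neg h : 0 < h < e -> q (t0 + h) < 0.
  move=> /andP[h0 hl].
  have /= := he h; rewrite /ball /= sub0r normrN gtr0_norm // gt_eqF // => /(_ hl isT).
  by rewrite subr0 /GRing.scale /= mulr1 pmulr_rlt0 ?invr_gt0 // addrC.
have cf : {within `[t0, t0 + e / 2], continuous f}.
  by apply: derivable_within_continuous => t _; have [] := df t.
have lt : t0 < t0 + e / 2 by lra.
have [c] := MVT lt (fun x _ => df x) cf.
rewrite in_itv /= => /andP[c1 c2] E.
have := fmin (t0 + e / 2); rewrite -subr_ge0 E.
have -> : t0 + e / 2 - t0 = e / 2 by ring.
rewrite pmulr_lge0; last by lra.
have -> : c = t0 + (c - t0) by ring.
by rewrite leNgt neg //; lra.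
Qed.

Lemma has_diff_is_derive (f : R -> R) (t : R) l : has_diff f t l -> is_derive t 1 f (l 1).
Proof.
move=> [df fl]; apply: DeriveDef; first exact/derivable1_diffP.
by rewrite deriveE.
Qed.

Lemma has_diff0_cst (f : R -> R) : (forall t, has_diff f t (fun=> 0)) ->
  forall s t, f s = f t.
Proof. by move=> h s t; apply: is_derive_0_is_cst => x; exact: has_diff_is_derive (h x). Qed.

End OneVariable.

Lemma has_diffv_curve {R : realType} (u : R -> 'rV[R]_3) (t : R) d :
  is_derive t 1 u d -> has_diffv u t (fun w => w *: d).
Proof.
move=> [du ud] i; have fu := (derivable1_diffP u t).1 du.
apply: (has_diff_eq (has_diff_entry i fu)) => w.
by have /(congr1 (@^~ w)) /= -> := deriv1E du; rewrite derive1E ud.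
Qed.

Section Kepler.
Context {R : realType}.
Implicit Types (m M k : R) (x y : 'rV[R]_3).

(** The Laplace-Runge-Lenz vector, scaled to be m^2 M times the eccentricity
    vector. *)
Definition lrl m M y x : 'rV[R]_3 :=
  cross y (cross x y) - (m ^+ 2 * M * (enorm x)^-1) *: x.

Definition dlrl m M y x Y X : 'rV[R]_3 :=
  cross Y (cross x y) + cross y (cross X y + cross x Y) -
  ((- (m ^+ 2 * M * (dot x X / enorm x ^+ 3))) *: x +
   (m ^+ 2 * M * (enorm x)^-1) *: X).

Lemma has_diffv_lrl {V : normedModType R} m M (y x : V -> 'rV[R]_3) z dy dx :
  x z != 0 -> has_diffv y z dy -> has_diffv x z dx ->
  has_diffv (fun t => lrl m M (y t) (x t)) z
            (fun w => dlrl m M (y z) (x z) (dy w) (dx w)).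
Proof.
move=> x0 hy hx; have n0 : 0 < enorm (x z) by rewrite enorm_gt0.
apply: has_diffvB; first by apply: has_diffv_cross => //; apply: has_diffv_cross.
apply: has_diffvZ => //.
apply: has_diff_eq.
  by apply: has_diffZ; apply: has_diffV; [exact: lt0r_neq0|exact: has_diff_enorm].
by move=> w /=; field; exact: lt0r_neq0.
Qed.

Lemma enorm_lrl m M y x : 0 < m -> x != 0 ->
  enorm (lrl m M y x) ^+ 2 = (m ^+ 2 * M) ^+ 2 +
  enorm (cross x y) ^+ 2 * (2 * m * (enorm y ^+ 2 / (2 * m) - m * M / enorm x)).
Proof.
move=> m0 x0; have n0 : 0 < enorm x by rewrite enorm_gt0.
have -> : enorm (cross x y) ^+ 2 * (2 * m * (enorm y ^+ 2 / (2 * m) - m * M / enorm x)) =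
  enorm (cross x y) ^+ 2 * enorm y ^+ 2 -
  2 * (m ^+ 2 * M / enorm x) * enorm (cross x y) ^+ 2.
  by field; rewrite !lt0r_neq0.
have -> : (m ^+ 2 * M) ^+ 2 = (m ^+ 2 * M / enorm x) ^+ 2 * dot x x.
  by rewrite -enorm_sqr; field; rewrite !lt0r_neq0.
by rewrite /lrl !enorm_sqr; move: (_ / _) => a; coord; ring.
Qed.

Lemma lrl_perp m M y x : dot (cross x y) (lrl m M y x) = 0.
Proof. by rewrite /lrl; move: (_ / _) => a; coord; ring. Qed.

(** Along the motion y is parallel to x', and y' to x. With d = w / m and
    b = m^2 M / |x|^3 this is an identity between polynomials in d, b and the
    coordinates of x and y. *)
Lemma lrl_conserved m M Y X s t : m != 0 ->
  kepler_motion m M Y X -> lrl m M (Y s) (X s) = lrl m M (Y t) (X t).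
Proof.
move=> m0 kep; apply/rowP => i; move: s t.
apply: (@has_diff0_cst _ (fun s => lrl m M (Y s) (X s) 0 i)) => t.
have [X0 dX dY] := kep t.
have n0 : 0 < enorm (X t) by rewrite enorm_gt0.
have /has_diff_eq := has_diffv_lrl m M X0 (has_diffv_curve dY) (has_diffv_curve dX) i.
apply=> w /=.
suff -> : dlrl m M (Y t) (X t) (w *: (- (m * M / enorm (X t) ^+ 3) *: X t))
   (w *: (m^-1 *: Y t)) = 0 by rewrite mxE.
pose b := m ^+ 2 * M / enorm (X t) ^+ 3.
have -> : w *: (- (m * M / enorm (X t) ^+ 3) *: X t) = - (w / m * b) *: X t.
  by rewrite scalerA /b; congr (_ *: _); field; rewrite m0 lt0r_neq0.
have -> : w *: (m^-1 *: Y t) = (w / m) *: Y t by rewrite scalerA.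
rewrite /dlrl.
have -> : m ^+ 2 * M * (enorm (X t))^-1 = b * dot (X t) (X t).
  by rewrite -enorm_sqr /b; field; rewrite lt0r_neq0.
rewrite [m ^+ 2 * M * (dot _ _ / _)]mulrCA -/b.
move: (w / m) b (X t) (Y t) => d b x y.
by apply: eq_row3; coord; ring.
Qed.

(** At the point closest to the centre x . y = 0, so there the conserved vector
    is (|y|^2 - m^2 M / |x|) x. Its coefficient is, up to a positive factor, the
    second derivative of |x|^2, which is nonnegative at a minimum. *)
Lemma lrl_perihelion m M p P : 0 < m ->
  perihelion_direction m M p P ->
  [/\ x2 p != 0, enorm P = 1 &
   lrl m M (y2 p) (x2 p) = enorm (lrl m M (y2 p) (x2 p)) *: P].
Proof.
move=> m0 [Y [X [kep Y0 X0 [t0 [tmin ->]]]]].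
have mn0 := lt0r_neq0 m0.
have xn0 t : X t != 0 by have [] := kep t.
have rn0 t : 0 < enorm (X t) by rewrite enorm_gt0.
rewrite -Y0 -X0 (lrl_conserved 0 t0 mn0 kep); split=> //.
  by rewrite enormZ gtr0_norm ?invr_gt0 // mulVf // lt0r_neq0.
have dXX (t : R) : is_derive t 1 (fun s => dot (X s) (X s)) (2 * m^-1 * dot (X t) (Y t)).
  have [_ dX _] := kep t; have hX := has_diffv_curve dX.
  have := has_diff_is_derive (has_diff_dot hX hX).
  rewrite !scale1r => h.
  apply: (@is_derive_eq _ _ _ _ _ _ _ _ h).
  by coord; ring.
have dXY : is_derive t0 1 (fun s => 2 * m^-1 * dot (X s) (Y s))
    (2 * m^-1 * (m^-1 * dot (Y t0) (Y t0) - m * M / enorm (X t0))).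
  have [_ dX dY] := kep t0.
  have := has_diff_is_derive
    (has_diffZ (2 * m^-1) (has_diff_dot (has_diffv_curve dX) (has_diffv_curve dY))).
  rewrite !scale1r dotZl dotZr -enorm_sqr => h.
  apply: (@is_derive_eq _ _ _ _ _ _ _ _ h); congr (_ * (_ + _)).
  by rewrite -enorm_sqr; field; rewrite lt0r_neq0.
have [|q0 qd] := second_order_min dXX _ dXY.
  by move=> t; rewrite -!enorm_sqr ler_pXn2r ?nnegrE ?enorm_ge0.
have {q0} q0 : dot (X t0) (Y t0) = 0.
  by move/eqP: q0; rewrite !mulf_eq0 invr_eq0 pnatr_eq0 (negbTE mn0) => /eqP.
set x := X t0 in q0 qd *; set y := Y t0 in q0 qd *.
have rx : 0 < enorm x by exact: rn0.
pose a := dot y y - m ^+ 2 * M / enorm x.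
have a0 : 0 <= a.
  have -> : a = 2 * m^-1 * (m^-1 * dot y y - m * M / enorm x) * (m ^+ 2 / 2).
    by rewrite /a; field; rewrite mn0 lt0r_neq0.
  by rewrite mulr_ge0 // divr_ge0 // exprn_ge0 // ltW.
have -> : lrl m M y x = a *: x.
  by rewrite /lrl double_cross (dotC y x) q0 scale0r subr0 -scalerBl -/a.
rewrite enormZ ger0_norm // scalerA; congr (_ *: _).
by field; rewrite lt0r_neq0.
Qed.

End Kepler.

(** * Functions on phase space and their Hamiltonian fields *)

Section PhaseFunctions.
Context {R : realType}.
Variables m M : R.
Implicit Types p q : phase R.

Definition Lrl p := lrl m M (y2 p) (x2 p).
Definition dLrl p q := dlrl m M (y2 p) (x2 p) (y2 q) (x2 q).
Definition dC2 p q := cross (x2 q) (y2 p) + cross (x2 p) (y2 q).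
Definition dG2 p q := dot (C2 p) (dC2 p q) / G2 p.
Definition drho p q := dot (x1 p) (x1 q) / rho p.
Definition dTheta p q :=
  (dot (x1 q) (C2 p) + dot (x1 p) (dC2 p q)) / rho p
  - dot (x1 p) (C2 p) * dot (x1 p) (x1 q) / rho p ^+ 3.
Definition denergy p q :=
  dot (y2 p) (y2 q) / m + m * M * dot (x2 p) (x2 q) / enorm (x2 p) ^+ 3.
(** The function B with E0 = G^2 - B. Up to a factor depending only on Lambda, G
    and Theta, it is - rho cos phi, and [x1_lrl_perp] is rho sin phi. *)
Definition x1_lrl p := dot (x1 p) (Lrl p).
Definition dx1_lrl p q := dot (x1 q) (Lrl p) + dot (x1 p) (dLrl p q).
Definition x1_lrl_perp p := dot (x1 p) (cross (C2 p) (Lrl p)) / G2 p.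
Definition dx1_lrl_perp p q :=
  (dot (x1 q) (cross (C2 p) (Lrl p)) +
   dot (x1 p) (cross (dC2 p q) (Lrl p) + cross (C2 p) (dLrl p q))) / G2 p
  - dot (x1 p) (cross (C2 p) (Lrl p)) * dG2 p q / G2 p ^+ 2.

Context {V : normedModType R}.
Variables (C : V -> phase R) (z : V).
Hypothesis dC : differentiable C z.

Lemma has_diffv_y2 : has_diffv (fun t => y2 (C t)) z (fun w => y2 ('d C z w)).
Proof.
have [d1 e1] := diff_fst dC; have [d2 e2] := diff_snd d1.
move=> i; apply: (has_diff_eq (has_diff_entry i d2)) => w.
by rewrite e2 e1.
Qed.

Lemma has_diffv_x1 : has_diffv (fun t => x1 (C t)) z (fun w => x1 ('d C z w)).
Proof.
have [d1 e1] := diff_snd dC; have [d2 e2] := diff_fst d1.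
move=> i; apply: (has_diff_eq (has_diff_entry i d2)) => w.
by rewrite e2 e1.
Qed.

Lemma has_diffv_x2 : has_diffv (fun t => x2 (C t)) z (fun w => x2 ('d C z w)).
Proof.
have [d1 e1] := diff_snd dC; have [d2 e2] := diff_snd d1.
move=> i; apply: (has_diff_eq (has_diff_entry i d2)) => w.
by rewrite e2 e1.
Qed.

Lemma has_diffv_C2 : has_diffv (fun t => C2 (C t)) z (fun w => dC2 (C z) ('d C z w)).
Proof. exact: has_diffv_cross has_diffv_x2 has_diffv_y2. Qed.

Hypothesis x10 : x1 (C z) != 0.
Hypothesis C20 : C2 (C z) != 0.

Lemma C2_x2_neq0 : x2 (C z) != 0.
Proof. by apply: contraNneq C20 => e; rewrite /C2 e cross0v. Qed.

Lemma rho_gt0 : 0 < rho (C z).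
Proof. by rewrite enorm_gt0. Qed.

Lemma G2_gt0 : 0 < G2 (C z).
Proof. by rewrite enorm_gt0. Qed.

Lemma has_diff_G2 : has_diff (fun t => G2 (C t)) z (fun w => dG2 (C z) ('d C z w)).
Proof. exact: (has_diff_enorm (u := fun t => C2 (C t)) C20 has_diffv_C2). Qed.

Lemma has_diff_rho : has_diff (fun t => rho (C t)) z (fun w => drho (C z) ('d C z w)).
Proof. exact: (has_diff_enorm (u := fun t => x1 (C t)) x10 has_diffv_x1). Qed.

Lemma has_diff_Theta :
  has_diff (fun t => Theta (C t)) z (fun w => dTheta (C z) ('d C z w)).
Proof.
have n0 := lt0r_neq0 rho_gt0.
apply: has_diff_eq.
  apply: has_diffM; first exact: has_diff_dot has_diffv_x1 has_diffv_C2.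
  by apply: has_diffV; [exact: n0|exact: has_diff_rho].
by move=> w; rewrite /dTheta /drho -/(rho (C z)) /=; field.
Qed.

Lemma has_diff_energy : m != 0 ->
  has_diff (fun t => kepler_energy m M (C t)) z (fun w => denergy (C z) ('d C z w)).
Proof.
move=> m0.
have x20 := C2_x2_neq0; have n0 : enorm (x2 (C z)) != 0 by rewrite lt0r_neq0 ?enorm_gt0.
apply: has_diff_eq.
  apply: has_diffB.
    apply: has_diffM; last exact: has_diff_cst.
    under eq_fun do rewrite enorm_sqr.
    exact: has_diff_dot has_diffv_y2 has_diffv_y2.
  apply: has_diffZ; apply: has_diffV; last exact: (has_diff_enorm (u := fun t => x2 (C t)) x20 has_diffv_x2).
  exact: n0.
move=> w; rewrite /denergy (dotC _ (y2 (C z))) /=; field.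
by rewrite n0 m0.
Qed.

Lemma has_diffv_Lrl : has_diffv (fun t => Lrl (C t)) z (fun w => dLrl (C z) ('d C z w)).
Proof. exact: (has_diffv_lrl (x := fun t => x2 (C t)) _ _ C2_x2_neq0 has_diffv_y2 has_diffv_x2). Qed.

Lemma has_diff_x1_lrl : has_diff (fun t => x1_lrl (C t)) z (fun w => dx1_lrl (C z) ('d C z w)).
Proof. exact: has_diff_dot has_diffv_x1 has_diffv_Lrl. Qed.

Lemma has_diff_x1_lrl_perp : has_diff (fun t => x1_lrl_perp (C t)) z (fun w => dx1_lrl_perp (C z) ('d C z w)).
Proof.
have n0 := lt0r_neq0 G2_gt0.
apply: has_diff_eq.
  apply: has_diffM.
    apply: has_diff_dot has_diffv_x1 _.
    exact: has_diffv_cross has_diffv_C2 has_diffv_Lrl.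
  by apply: has_diffV; [exact: n0|exact: has_diff_G2].
by move=> w; rewrite /dx1_lrl_perp /=; field.
Qed.

End PhaseFunctions.

Section HamiltonianFields.
Context {R : realType}.
Variables m M : R.
Implicit Types p q : phase R.

(** The Hamiltonian field of [x1_lrl]: its y1, y2, x1, x2 components are the
    derivatives of x1 . A in x1 and x2, and minus those in y1 and y2. *)
Definition x1_lrl_field p : phase R :=
  let y := y2 p in let x := x2 p in let n := x1 p in
  ((Lrl m M p,
    dot y y *: n - dot n y *: y - (m ^+ 2 * M * (enorm x)^-1) *: n
    + (m ^+ 2 * M * (dot n x / enorm x ^+ 3)) *: x),
   (0, dot x y *: n + dot n y *: x - (2 * dot n x) *: y)).

(** Minus the Hamiltonian field of G: the unit rotation of (x2, y2) about C2. *)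
Definition spin p : phase R :=
  ((0, (G2 p)^-1 *: cross (C2 p) (y2 p)), (0, (G2 p)^-1 *: cross (C2 p) (x2 p))).

Lemma x1_lrl_fieldP p q : phase_form (x1_lrl_field p) q = dx1_lrl m M p q.
Proof.
rewrite /phase_form /dx1_lrl /x1_lrl_field /dLrl /dlrl /Lrl /=; rewrite /y1 /x1 /y2 /x2 /=.
case: p q => [[y0 y] [n x]] [[Y1 Y] [X1 X]] /=.
by move: (enorm x)^-1 (enorm x ^+ 3)^-1 => a b; coord; ring.
Qed.

Lemma spinP p q : phase_form (spin p) q = - dG2 p q.
Proof.
rewrite /phase_form /dG2 /spin /dC2 /C2 /=; rewrite /y1 /x1 /y2 /x2 /=.
case: p q => [[y0 y] [n x]] [[Y1 Y] [X1 X]] /=.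
by move: (G2 _)^-1 => a; coord; ring.
Qed.

Lemma denergy_x1_lrl_field p : m != 0 -> x2 p != 0 -> denergy m M p (x1_lrl_field p) = 0.
Proof.
move=> m0 x20; have n0 : enorm (x2 p) != 0 by rewrite lt0r_neq0 // enorm_gt0.
rewrite /denergy /x1_lrl_field; case: p x20 n0 => [[y0 y] [n x]] /=; rewrite /y1 /x1 /y2 /x2 /= => x20 n0.
have -> : m ^+ 2 * M * (enorm x)^-1 = m ^+ 2 * M * (enorm x ^+ 3)^-1 * dot x x.
  by rewrite -enorm_sqr; field.
move: (enorm x ^+ 3)^-1 => a; coord; field.
exact: m0.
Qed.

Lemma dTheta_x1_lrl_field p : dTheta p (x1_lrl_field p) = 0.
Proof.
rewrite /dTheta /dC2 /C2 /x1_lrl_field; case: p => [[y0 y] [n x]] /=; rewrite /y1 /x1 /y2 /x2 /=.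
rewrite /rho /= /x1 /=; move: (enorm n)^-1 (enorm n ^+ 3)^-1 (enorm x)^-1 (enorm x ^+ 3)^-1 => a b c d.
by coord; ring.
Qed.

Lemma drho_x1_lrl_field p : drho p (x1_lrl_field p) = 0.
Proof. by rewrite /drho /x1_lrl_field /= /x1 /= dotC dot0v mul0r. Qed.

Lemma dG2_x1_lrl_field p : dG2 p (x1_lrl_field p) = x1_lrl_perp m M p.
Proof.
rewrite /dG2 /x1_lrl_perp /dC2 /C2 /x1_lrl_field /Lrl /lrl; case: p => [[y0 y] [n x]] /=; rewrite /y1 /x1 /y2 /x2 /=.
by congr (_ / _); move: (enorm x)^-1 (enorm x ^+ 3)^-1 => c d; coord; ring.
Qed.

Lemma dC2_spin p : dC2 p (spin p) = 0.
Proof.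
rewrite /dC2 /spin /C2; case: p => [[y0 y] [n x]] /=; rewrite /y1 /x1 /y2 /x2 /=.
by move: (G2 _)^-1 => a; apply: eq_row3; coord; ring.
Qed.

Lemma dTheta_spin p : dTheta p (spin p) = 0.
Proof.
by rewrite /dTheta dC2_spin /spin /x1 /= dot0v (dotC _ 0) dot0v !(mulr0,mul0r,addr0,subr0).
Qed.

Lemma drho_spin p : drho p (spin p) = 0.
Proof. by rewrite /drho /spin /= /x1 /= dotC dot0v mul0r. Qed.

Lemma dLrl_spin p : dLrl m M p (spin p) = (G2 p)^-1 *: cross (C2 p) (Lrl m M p).
Proof.
rewrite /dLrl /spin /dlrl /Lrl /lrl /C2; case: p => [[y0 y] [n x]] /=; rewrite /y1 /x1 /y2 /x2 /=.
move: (G2 _)^-1 (enorm x)^-1 (enorm x ^+ 3)^-1 => a b c; apply: eq_row3; coord; ring.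
Qed.

Lemma dx1_lrl_spin p : dx1_lrl m M p (spin p) = x1_lrl_perp m M p.
Proof.
by rewrite /dx1_lrl dLrl_spin /spin /x1 /= dot0v add0r dotZr mulrC.
Qed.

Lemma dG2_spin p : dG2 p (spin p) = 0.
Proof. by rewrite /dG2 dC2_spin dotC dot0v mul0r. Qed.

Lemma dx1_lrl_perp_spin p : C2 p != 0 -> dx1_lrl_perp m M p (spin p) = - x1_lrl m M p.
Proof.
move=> C20; have n0 : enorm (C2 p) != 0 by rewrite lt0r_neq0 // enorm_gt0.
rewrite /dx1_lrl_perp dC2_spin dG2_spin dLrl_spin /spin /x1 /= dot0v add0r mulr0 mul0r subr0.
rewrite cross0v add0r crossZr double_cross lrl_perp scale0r sub0r -enorm_sqr -/(G2 p).
have -> : - (G2 p ^+ 2 *: Lrl m M p) = (- G2 p ^+ 2) *: Lrl m M p by rewrite scaleNr.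
by rewrite /x1_lrl scalerA dotZr; field.
Qed.

End HamiltonianFields.

(** * Linear symplectic algebra *)

Section SymplecticAlgebra.
Context {R : realType}.
Implicit Types (a b : coords R) (p q : phase R).

Lemma coords_decomp a : a = a.1.1 *: eLam + a.1.2 *: eell +
  (\sum_(i < 5) a.2.1 0 i *: eu i + \sum_(i < 5) a.2.2 0 i *: ev i).
Proof.
have su : \sum_(i < 5) a.2.1 0 i *: eu i = ((0, 0), (a.2.1, 0)) :> coords R.
  rewrite [X in ((0, 0), (X, 0))]row_sum_delta.
  elim/big_ind2 : _ => //= [x x' y y' -> ->|i _].
    by congr ((_, _), (_, _)); rewrite /= ?addr0.
  by congr ((_, _), (_, _)); rewrite /= ?scaler0 ?mulr0.
have sv : \sum_(i < 5) a.2.2 0 i *: ev i = ((0, 0), (0, a.2.2)) :> coords R.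
  rewrite [X in ((0, 0), (0, X))]row_sum_delta.
  elim/big_ind2 : _ => //= [x x' y y' -> ->|i _].
    by congr ((_, _), (_, _)); rewrite /= ?addr0.
  by congr ((_, _), (_, _)); rewrite /= ?scaler0 ?mulr0.
rewrite su sv; case: a {su sv} => [[l e] [u v]] /=.
congr ((_, _), (_, _)); rewrite /= ?scaler0 ?addr0 ?add0r // /GRing.scale /=.
  by rewrite mulr1.
by rewrite mulr1.
Qed.

Lemma coords_form_inj a : (forall b, coords_form a b = 0) -> a = 0.
Proof.
move=> h; case: a h => [[l e] [u v]] h.
have := h eell; have := h eLam; rewrite /coords_form /=.
rewrite !big1; try by move=> i _; rewrite !mxE; ring.
move=> h1 h2; congr ((_, _), (_, _)); first by move: h2 => /=; lra.
- by move: h1 => /=; lra.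
- apply/rowP => i; have := h (ev i); rewrite /coords_form /= (bigD1 i) //= big1.
    by rewrite !mxE !eqxx /=; lra.
  by move=> j ji; rewrite !mxE (negbTE ji) andbF /=; ring.
- apply/rowP => i; have := h (eu i); rewrite /coords_form /= (bigD1 i) //= big1.
    by rewrite !mxE !eqxx /=; lra.
  by move=> j ji; rewrite !mxE (negbTE ji) andbF /=; ring.
Qed.

Lemma dot_inj (u : 'rV[R]_3) : (forall v, dot u v = 0) -> u = 0.
Proof. by move=> h; apply/eqP; rewrite -dot_eq0 h. Qed.

Lemma phase_form_inj p p' : (forall q, phase_form p q = phase_form p' q) -> p = p'.
Proof.
have E (u u' : 'rV[R]_3) : (forall v, dot u v = dot u' v) -> u = u'.
  move=> h; apply/subr0_eq/dot_inj => v; have := h v; coord; lra.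
move=> h; case: p p' h => [[Y1 Y2] [X1 X2]] [[Y1' Y2'] [X1' X2']] h.
congr ((_, _), (_, _)); apply: E => v.
- have := h ((0, 0), (v, 0)); rewrite /phase_form /y1 /y2 /x1 /x2 /=; coord; lra.
- have := h ((0, 0), (0, v)); rewrite /phase_form /y1 /y2 /x1 /x2 /=; coord; lra.
- have := h ((v, 0), (0, 0)); rewrite /phase_form /y1 /y2 /x1 /x2 /=; coord; lra.
- have := h ((0, v), (0, 0)); rewrite /phase_form /y1 /y2 /x1 /x2 /=; coord; lra.
Qed.

(** Since the two-form on coordinates is nondegenerate, d is injective; both spaces
    have dimension 12, so d is onto. *)
Lemma symplectic_surj (d : {linear coords R -> phase R}) :
  (forall a b, phase_form (d a) (d b) = coords_form a b) ->
  forall q, exists a, d a = q.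
Proof.
move=> dform q.
have dinj a : d a = 0 -> a = 0.
  move=> da; apply: coords_form_inj => b; rewrite -dform da.
  by rewrite /phase_form /y1 /y2 /x1 /x2 /=; coord; ring.
pose toP (p : phase R) : 'rV[R]_12 := row_mx (row_mx p.1.1 p.1.2) (row_mx p.2.1 p.2.2).
pose ofC (v : 'rV[R]_12) : coords R :=
  let v1 : 'rV[R]_(1 + 1) := lsubmx (v : 'rV[R]_((1 + 1) + (5 + 5))) in
  let v2 : 'rV[R]_(5 + 5) := rsubmx (v : 'rV[R]_((1 + 1) + (5 + 5))) in
  ((lsubmx v1 0 0, rsubmx v1 0 0), (lsubmx v2, rsubmx v2)).
have toP_inj : injective toP.
  move=> [[a b] [c e]] [[a' b'] [c' e']] h.
  have [h1 h2] := @eq_row_mx _ 1 (3 + 3) (3 + 3) _ _ _ _ h.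
  by have [/= -> ->] := eq_row_mx h1; have [/= -> ->] := eq_row_mx h2.
have ofC_inj v : ofC v = 0 -> v = 0.
  have split0 m n (x : 'rV[R]_(m + n)) : lsubmx x = 0 -> rsubmx x = 0 -> x = 0.
    by move=> e1 e2; rewrite -[x]hsubmxK e1 e2 row_mx0.
  case=> h1 h2 h3 h4.
  apply: (split0 (1 + 1)%N (5 + 5)%N); apply: split0 => //.
    by apply/rowP => i; rewrite !ord1 h1 mxE.
  by apply/rowP => i; rewrite !ord1 h2 mxE.
pose f v := toP (d (ofC v)).
have flin : linear f.
  move=> k u v; rewrite /f.
  have -> : ofC (k *: u + v) = k *: ofC u + ofC v.
    by congr ((_, _), (_, _)); rewrite /= ?linearP // !mxE.
  rewrite linearP /toP.
  rewrite (@scale_row_mx _ 1 (3 + 3) (3 + 3)) (@add_row_mx _ 1 (3 + 3) (3 + 3)).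
  by rewrite !scale_row_mx !add_row_mx.
pose fM := GRing.isLinear.Build _ _ _ _ _ flin.
pose F : {linear 'rV[R]_12 -> 'rV[R]_12} := HB.pack f fM.
have fr : row_free (lin1_mx F).
  apply/inj_row_free => v; rewrite mul_rV_lin1 /= /f => h.
  apply: ofC_inj; apply: dinj; apply: toP_inj; rewrite h /toP /=.
  by rewrite !row_mx0.
have full : row_full (lin1_mx F) by rewrite row_full_unit -row_free_unit.
have /submxP[v E] := submx_full (toP q) full.
by exists (ofC v); apply: toP_inj; rewrite E mul_rV_lin1.
Qed.

(** The Hamiltonian vector field, with the sign for which the bracket of f with g
    is the derivative of f along it. *)
Definition Xham (g : coords R -> R) (z : coords R) : coords R :=
  (('D_eell g z, - 'D_eLam g z),
   (\row_i 'D_(ev i) g z, - (\row_i 'D_(eu i) g z))).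

Lemma poissonE (f g : coords R -> R) z :
  differentiable f z -> poisson f g z = 'd f z (Xham g z).
Proof.
move=> df.
have dZ k v : 'd f z (k *: v) = k * 'd f z v by exact: linearZ.
rewrite [Xham g z]coords_decomp !linearD !dZ !linear_sum -!(deriveE _ df) -big_split /=.
rewrite /poisson; congr (_ + _).
  move: ('D_eLam f z) ('D_eell f z) ('D_eLam g z) ('D_eell g z) => a b c d.
  by ring.
apply: eq_bigr => i _; rewrite !dZ -!(deriveE _ df) !mxE.
by move: ('D_(eu i) f z) ('D_(ev i) f z) ('D_(eu i) g z) ('D_(ev i) g z) => a b c d; ring.
Qed.

Lemma coords_form_Xham g z a : differentiable g z ->
  coords_form (Xham g z) a = 'd g z a.
Proof.
move=> dg.
have dZ k v : 'd g z (k *: v) = k * 'd g z v by exact: linearZ.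
rewrite {2}[a]coords_decomp !linearD !dZ !linear_sum -!(deriveE _ dg) -big_split /=.
rewrite /coords_form /=; congr (_ + _).
  by move: ('D_eLam g z) ('D_eell g z) => c d; ring.
apply: eq_bigr => i _; rewrite !dZ -!(deriveE _ dg) !mxE.
by move: ('D_(eu i) g z) ('D_(ev i) g z) => c d; ring.
Qed.

End SymplecticAlgebra.

(** * Derivatives along level sets *)

Section LevelSets.
Context {R : realType} {V : normedModType R}.
Implicit Types (f T : V -> R) (z e w : V).

Lemma has_diff_eps f z l (eps : R) : has_diff f z l -> 0 < eps ->
  \forall h \near 0, `|f (z + h) - f z - l h| <= eps * `|h|.
Proof.
move=> [df fl] e0; have /eqaddoP/(_ _ e0) := (diff_locally df).
apply: filterS => h /=; rewrite !fctE /= fl.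
by rewrite (addrC h z) opprD addrA.
Qed.

Lemma is_derive_eps (phi : R -> R) (d : R) :
  (forall eps : R, 0 < eps ->
     \forall t \near 0, `|phi t - phi 0 - t * d| <= eps * `|t|) ->
  is_derive (0 : R) 1 phi d.
Proof.
move=> h.
have c : h^-1 *: (phi (h *: 1 + 0) - phi 0) @[h --> 0^'] --> d.
  apply/cvgrPdist_le => eps e0; have := h _ e0.
  move=> /(@nbhs_dnbhs _ 0) hh; near=> t.
  have t0 : t != 0 by near: t; exact: nbhs_dnbhs_neq.
  rewrite addr0 /GRing.scale /= mulr1 distrC.
  have -> : t^-1 * (phi t - phi 0) - d = (phi t - phi 0 - t * d) / t by field.
  rewrite normrM normfV ler_pdivrMr ?normr_gt0 //.
  by near: t; exact: hh.
by apply: DeriveDef; [apply/cvg_ex; exists d|apply: cvg_lim].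
Unshelve. all: by end_near. Qed.

Lemma near0_ball (P : V -> Prop) : (\forall h \near 0, P h) ->
  exists2 d : R, 0 < d & forall h, `|h| < d -> P h.
Proof.
move=> /nbhs_ballP[d /= d0 hd]; exists d => // h hh; apply: hd.
by rewrite -ball_normE /= sub0r normrN.
Qed.

(** To first order, T (z + t w + s e) - T z is s times the nonzero number dT e.
    So, once t is small, it is nonnegative at one of s = eps |t|, s = - eps |t| and
    nonpositive at the other, and vanishes in between. *)
Lemma level_set_approx T z dT e w (eps : R) :
  (\forall h \near 0, {for z + h, continuous T}) -> has_diff T z dT ->
  dT e != 0 -> dT w = 0 -> 0 < eps ->
  \forall t \near 0, exists2 s : R, `|s| <= eps * `|t| &
     T (z + (t *: w + s *: e)) = T z.
Proof.
move=> cT hT e0 w0 eps0.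
have dTD s t : dT (t *: w + s *: e) = s * dT e.
  by rewrite (has_diff_linear _ _ _ _ hT) w0 mulr0 add0r.
pose N := `|w| + eps * `|e| + 1.
have N0 : 0 < N.
  by rewrite ltr_pwDr // addr_ge0 // mulr_ge0 // ltW.
have c0 : 0 < `|dT e| by rewrite normr_gt0.
have eta0 : 0 < eps * `|dT e| / N by rewrite divr_gt0 // mulr_gt0.
have [d1 d10 H1] := near0_ball (has_diff_eps hT eta0).
have [d2 d20 H2] := near0_ball cT.
have dN : 0 < Num.min d1 d2 / N by rewrite divr_gt0 // lt_min d10 d20.
apply/nbhs_ballP; exists (Num.min d1 d2 / N) => //= t.
rewrite /ball /= sub0r normrN ltr_pdivlMr // lt_min => /andP[td1 td2].
have hN s : `|s| <= eps * `|t| -> `|t *: w + s *: e| <= `|t| * N.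
  move=> hs; apply: (le_trans (ler_normD _ _)); rewrite !normrZ /N.
  have : `|s| * `|e| <= eps * `|t| * `|e| by rewrite ler_wpM2r.
  by have := normr_ge0 t; lra.
pose r := eps * `|t|; have r0 : 0 <= r by rewrite mulr_ge0 // ltW.
pose g s := T (z + (t *: w + s *: e)).
have err s : `|s| = r -> `|g s - T z - s * dT e| <= r * `|dT e|.
  move=> sr; have hs : `|s| <= eps * `|t| by rewrite sr.
  have := H1 _ (le_lt_trans (hN _ hs) td1); rewrite dTD => /le_trans; apply.
  apply: (@le_trans _ _ (eps * `|dT e| / N * (`|t| * N))).
    by rewrite ler_wpM2l ?hN // ltW.
  by rewrite /r le_eqVlt; apply/orP; left; apply/eqP; field; rewrite lt0r_neq0.
have cg : {within `[- r, r], continuous g}.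
  apply: continuous_in_subspaceT => s; rewrite inE /= in_itv /= -ler_norml => hs.
  have ct := H2 _ (le_lt_trans (hN _ hs) td2).
  have ca : {for s, continuous (fun x : R => z + (t *: w + x *: e))}; last first.
    exact: (continuous_comp ca ct).
  apply: continuousD; first exact: cst_continuous.
  apply: continuousD; first exact: cst_continuous.
  exact: scalel_continuous.
have rr : - r <= r by rewrite ge0_cp.
have [|s] := IVT rr cg (v := T z).
  have e1 := err r (ger0_norm r0).
  have e2 := err (- r) (etrans (normrN r) (ger0_norm r0)).
  rewrite ge_min le_max.
  move: e1 e2; rewrite !ler_norml => /andP[a1 a2] /andP[b1 b2].
  have [cp|cn] := leP 0 (dT e).
    by rewrite (ger0_norm cp) in a1 a2 b1 b2; apply/andP; split; apply/orP; [left|right]; lra.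
  by rewrite (ltr0_norm cn) in a1 a2 b1 b2; apply/andP; split; apply/orP; [right|left]; lra.
rewrite in_itv /= -ler_norml => hs gs; exists s => //.
Qed.

(** The points z + t w + s e of [level_set_approx] have s = o(t), so f there is
    f z + t (df w) + o(t); and it is phi t by assumption. *)
Lemma level_set_derive T z dT e w (f : V -> R) df (phi : R -> R) :
  (\forall h \near 0, {for z + h, continuous T}) -> has_diff T z dT ->
  dT e != 0 -> dT w = 0 -> has_diff f z df ->
  (\forall h \near 0, forall s t, h = t *: w + s *: e ->
     T (z + h) = T z -> f (z + h) = phi t) ->
  is_derive (0 : R) 1 phi (df w).
Proof.
move=> cT hT e0 w0 hf hphi; apply: is_derive_eps => eps eps0.
pose N := `|w| + `|e| + 1.
have N0 : 0 < N by rewrite ltr_pwDr // addr_ge0.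
have [d1 d10 H1] := near0_ball hphi.
pose K := N + `|df e|.
have K0 : 0 < K by rewrite ltr_pwDl.
have epsK : 0 < eps / K by rewrite divr_gt0.
have [d2 d20 H2] := near0_ball (has_diff_eps hf epsK).
have z00 : f z = phi 0.
  have := H1 0; rewrite normr0 addr0 => /(_ d10 0 0) -> //.
  by rewrite !scale0r addr0.
(* The error budget eps |t| pays for the remainder of f at t w + s e, of size at
   most N |t|, and for s (df e). *)
pose eps' := Num.min 1 (eps / K).
have eps'0 : 0 < eps' by rewrite lt_min ltr01.
have dN : 0 < Num.min d1 d2 / N by rewrite divr_gt0 // lt_min d10 d20.
have ht : \forall t \near (0 : R), `|t| < Num.min d1 d2 / N.
  by apply/nbhs_ballP; exists (Num.min d1 d2 / N) => //= x; rewrite /ball /= sub0r normrN.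
near=> t.
have [s hs Ts] : exists2 s : R, `|s| <= eps' * `|t| & T (z + (t *: w + s *: e)) = T z.
  by near: t; exact: (level_set_approx cT hT e0 w0 eps'0).
have /andP[td1 td2] : (`|t| * N < d1) && (`|t| * N < d2).
  by rewrite -lt_min -ltr_pdivlMr //; near: t.
have s1 : `|s| <= `|t|.
  by apply: (le_trans hs); rewrite ler_piMl // /eps' ge_min lexx.
have s2 : `|s| <= eps / K * `|t|.
  by apply: (le_trans hs); rewrite ler_wpM2r // /eps' ge_min lexx orbT.
have hN : `|t *: w + s *: e| <= `|t| * N.
  apply: (le_trans (ler_normD _ _)); rewrite !normrZ /N.
  have : `|s| * `|e| <= `|t| * `|e| by rewrite ler_wpM2r.
  by have := normr_ge0 t; lra.
have := H1 _ (le_lt_trans hN td1) s t erefl Ts => ft.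
have := H2 _ (le_lt_trans hN td2); rewrite ft -z00.
rewrite (has_diff_linear _ _ _ _ hf) => h.
have -> : phi t - f z - t * df w = (phi t - f z - (t * df w + s * df e)) + s * df e by ring.
apply: (le_trans (ler_normD _ _)); rewrite [`|s * _|]normrM.
have h2 : eps / K * `|t *: w + s *: e| <= eps / K * (`|t| * N) by rewrite ler_wpM2l // ltW.
have h3 : `|s| * `|df e| <= eps / K * `|t| * `|df e| by rewrite ler_wpM2r.
have -> : eps * `|t| = eps / K * (`|t| * N) + eps / K * `|t| * `|df e|.
  by rewrite /K; field; rewrite -/K lt0r_neq0.
lra.
Unshelve. all: by end_near. Qed.

End LevelSets.

(** * Harmonics of an angle *)

Section Harmonics.
Context {R : realType}.
Implicit Types (a : R) (k : nat).

Lemma succ_angle k a : k.+1%:R * a = k%:R * a + a.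
Proof. by rewrite -[k.+1]addn1 natrD mulrDl mul1r. Qed.

Lemma pred_angle k a : k%:R * a = k.+1%:R * a - a.
Proof. by rewrite succ_angle addrK. Qed.

Lemma cosSS k a : cos (k.+2%:R * a) = 2 * cos a * cos (k.+1%:R * a) - cos (k%:R * a).
Proof. by rewrite (succ_angle k.+1) (pred_angle k) cosB cosD; ring. Qed.

Lemma sinSS k a : sin (k.+2%:R * a) = 2 * cos a * sin (k.+1%:R * a) - sin (k%:R * a).
Proof. by rewrite (succ_angle k.+1) (pred_angle k) sinB sinD; ring. Qed.

Lemma sin_cosS k a : 2 * sin a * cos (k.+1%:R * a) = sin (k.+2%:R * a) - sin (k%:R * a).
Proof. by rewrite (succ_angle k.+1) (pred_angle k) sinB sinD; ring. Qed.

Lemma sin_sinS k a : 2 * sin a * sin (k.+1%:R * a) = cos (k%:R * a) - cos (k.+2%:R * a).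
Proof. by rewrite (succ_angle k.+1) (pred_angle k) cosB cosD; ring. Qed.

Context {V : normedModType R}.
(* The angle phi itself may jump by 2 pi; only its cosine and sine are
   differentiable. *)
Variables (phi : V -> R) (z : V) (dc : V -> R).
Hypothesis hc : has_diff (fun x => cos (phi x)) z dc.

(** The Chebyshev recurrence expresses cos (k phi) through cos phi alone. So its
    derivative along w is known as soon as that of cos phi is g sin phi, even
    where sin phi = 0 and g is not determined by it. *)
Lemma has_diff_cosk k : exists2 l, has_diff (fun x => cos (k%:R * phi x)) z l &
  forall w g, dc w = g * sin (phi z) -> l w = g * k%:R * sin (k%:R * phi z).
Proof.
have [//] : (exists2 l, has_diff (fun x => cos (k%:R * phi x)) z l &
  forall w g, dc w = g * sin (phi z) -> l w = g * k%:R * sin (k%:R * phi z)) /\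
  (exists2 l, has_diff (fun x => cos (k.+1%:R * phi x)) z l &
  forall w g, dc w = g * sin (phi z) -> l w = g * k.+1%:R * sin (k.+1%:R * phi z)).
elim: k => [|k [[l hl lE] [l1 hl1 lE1]]].
  split.
    exists (fun=> 0); last by move=> w g _; rewrite mulr0 mul0r.
    under eq_fun do rewrite mul0r cos0; exact: has_diff_cst.
  exists dc; last by move=> w g ->; rewrite mulr1 mul1r.
  by under eq_fun do rewrite mul1r.
split; first by exists l1.
exists (fun w => (2 * cos (phi z)) * l1 w + cos (k.+1%:R * phi z) * (2 * dc w) - l w).
  under eq_fun do rewrite cosSS.
  by apply: has_diffB => //; apply: has_diffM => //; apply: has_diffZ.
move=> w g e; rewrite (lE _ _ e) (lE1 _ _ e) e.
have := sin_cosS k (phi z); have := sinSS k (phi z).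
move: (sin (k.+2%:R * _)) (sin (k.+1%:R * _)) (cos (k.+1%:R * _)) (sin (k%:R * _)).
move=> s2 s1 c1 s0 h1 h2; rewrite -[k.+2]addn2 -[k.+1]addn1 !natrD.
transitivity (g * ((k%:R + 1) * (2 * cos (phi z) * s1) + 2 * sin (phi z) * c1 - k%:R * s0)).
  by ring.
by rewrite h2 -(subrK s0 (2 * _ * s1)) -h1; ring.
Qed.

Lemma has_diff_sink ds : has_diff (fun x => sin (phi x)) z ds ->
  forall k, exists2 l, has_diff (fun x => sin (k%:R * phi x)) z l &
  forall w g, dc w = g * sin (phi z) -> ds w = - g * cos (phi z) ->
    l w = - g * k%:R * cos (k%:R * phi z).
Proof.
move=> hs k.
have [//] : (exists2 l, has_diff (fun x => sin (k%:R * phi x)) z l &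
  forall w g, dc w = g * sin (phi z) -> ds w = - g * cos (phi z) ->
    l w = - g * k%:R * cos (k%:R * phi z)) /\
  (exists2 l, has_diff (fun x => sin (k.+1%:R * phi x)) z l &
  forall w g, dc w = g * sin (phi z) -> ds w = - g * cos (phi z) ->
    l w = - g * k.+1%:R * cos (k.+1%:R * phi z)).
elim: k => [|k [[l hl lE] [l1 hl1 lE1]]].
  split.
    exists (fun=> 0); last by move=> w g _ _; rewrite mulr0 mul0r.
    under eq_fun do rewrite mul0r sin0; exact: has_diff_cst.
  exists ds; last by move=> w g _ ->; rewrite mulr1 mul1r.
  by under eq_fun do rewrite mul1r.
split; first by exists l1.
exists (fun w => (2 * cos (phi z)) * l1 w + sin (k.+1%:R * phi z) * (2 * dc w) - l w).
  under eq_fun do rewrite sinSS.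
  by apply: has_diffB => //; apply: has_diffM => //; apply: has_diffZ.
move=> w g e e'; rewrite (lE _ _ e e') (lE1 _ _ e e') e.
have := sin_sinS k (phi z); have := cosSS k (phi z).
move: (cos (k.+2%:R * _)) (cos (k.+1%:R * _)) (sin (k.+1%:R * _)) (cos (k%:R * _)).
move=> c2 c1 s1 c0 h1 h2; rewrite -[k.+2]addn2 -[k.+1]addn1 !natrD.
transitivity (g * (- (k%:R + 1) * (2 * cos (phi z) * c1) + 2 * sin (phi z) * s1 + k%:R * c0)).
  by ring.
by rewrite h2 -(subrK c0 (2 * _ * c1)) -h1; ring.
Qed.

End Harmonics.

(** * Finite trigonometric expansions *)

Section FiniteExpansions.
Context {R : realType} {T : Type}.
Variables (S : T -> Prop) (phi r : T -> R).
Implicit Types (K n k j q : nat) (al be : nat -> nat -> R) (z : T).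

Definition trig_poly K al be z : R :=
  \sum_(n < K) \sum_(k < K)
    (al n k * cos (k%:R * phi z) + be n k * sin (k%:R * phi z)) * r z ^+ n.

Lemma trig_poly_lin K al be al' be' a b z :
  a * trig_poly K al be z + b * trig_poly K al' be' z =
  trig_poly K (fun n k => a * al n k + b * al' n k)
              (fun n k => a * be n k + b * be' n k) z.
Proof.
rewrite /trig_poly !mulr_sumr -big_split; apply: eq_bigr => n _ /=.
by rewrite !mulr_sumr -big_split; apply: eq_bigr => k _ /=; ring.
Qed.

Lemma eq_trig_poly K al be al' be' z :
  (forall n k, (n < K)%N -> (k < K)%N -> al n k = al' n k /\ be n k = be' n k) ->
  trig_poly K al be z = trig_poly K al' be' z.
Proof.
move=> h; apply: eq_bigr => n _; apply: eq_bigr => k _.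
by have [-> ->] := h n k (ltn_ord n) (ltn_ord k).
Qed.

Lemma trig_poly_widen K K' al be z : (K <= K')%N ->
  (forall n k, (K <= maxn n k)%N -> al n k = 0 /\ be n k = 0) ->
  trig_poly K' al be z = trig_poly K al be z.
Proof.
move=> KK h; rewrite /trig_poly.
pose f n k := (al n k * cos (k%:R * phi z) + be n k * sin (k%:R * phi z)) * r z ^+ n.
have f0 n k : (K <= maxn n k)%N -> f n k = 0.
  by move=> /h [e1 e2]; rewrite /f e1 e2 !mul0r addr0 mul0r.
rewrite -/(f _ _) (big_ord_widen K' (fun n => \sum_(k < K) f n k) KK).
rewrite [RHS]big_mkcond; apply: eq_bigr => n _ /=; case: ltnP => nK.
  rewrite (big_ord_widen K' (fun k => f n k) KK) [RHS]big_mkcond.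
  by apply: eq_bigr => k _ /=; case: ltnP => // kK; apply: f0; rewrite leq_max kK orbT.
by rewrite big1 // => k _; apply: f0; rewrite leq_max nK.
Qed.

(** Truncation orders are only required to be large, so that expansions of
    different lengths can be added. *)
Definition has_coef (F : T -> R) j q b :=
  exists al be K0, (forall K z, (K0 <= K)%N -> S z -> F z = trig_poly K al be z) /\
    be j q = b.

Lemma has_coef_lin (F G : T -> R) j q b c x y : has_coef F j q b -> has_coef G j q c ->
  has_coef (fun z => x * F z + y * G z) j q (x * b + y * c).
Proof.
move=> [al [be [K1 [h1 <-]]]] [al' [be' [K2 [h2 <-]]]].
exists (fun n k => x * al n k + y * al' n k), (fun n k => x * be n k + y * be' n k).
exists (maxn K1 K2); split=> // K z; rewrite geq_max => /andP[k1 k2] Sz.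
by rewrite (h1 _ _ k1 Sz) (h2 _ _ k2 Sz) trig_poly_lin.
Qed.

Lemma has_coef_eq (F G : T -> R) j q b c : (forall z, S z -> F z = G z) -> b = c ->
  has_coef F j q b -> has_coef G j q c.
Proof.
move=> FG <- [al [be [K0 [h1 h2]]]]; exists al, be, K0; split=> // K z hK Sz.
by rewrite -FG // (h1 K).
Qed.

Lemma has_coef0 j q : has_coef (fun=> 0) j q 0.
Proof.
exists (fun _ _ => 0), (fun _ _ => 0), 0%N; split=> // K z _ _.
by rewrite /trig_poly big1 // => n _; rewrite big1 // => k _; rewrite !mul0r addr0 mul0r.
Qed.

Lemma has_coefD (F G : T -> R) j q b c : has_coef F j q b -> has_coef G j q c ->
  has_coef (fun z => F z + G z) j q (b + c).
Proof.
move=> hF hG; apply: has_coef_eq (has_coef_lin 1 1 hF hG); last by rewrite !mul1r.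
by move=> z _; rewrite !mul1r.
Qed.

Lemma has_coefZ (F : T -> R) j q b x : has_coef F j q b ->
  has_coef (fun z => x * F z) j q (x * b).
Proof.
move=> hF; apply: has_coef_eq (has_coef_lin x 0 hF (has_coef0 j q)); last by rewrite mul0r addr0.
by move=> z _; rewrite mul0r addr0.
Qed.

Lemma has_coef_sum K (F : 'I_K -> T -> R) (b : 'I_K -> R) j q :
  (forall i, has_coef (F i) j q (b i)) ->
  has_coef (fun z => \sum_(i < K) F i z) j q (\sum_(i < K) b i).
Proof.
elim: K F b => [|K IH] F b h.
  apply: has_coef_eq (has_coef0 j q); last by rewrite big_ord0.
  by move=> z _; rewrite big_ord0.
apply: has_coef_eq (has_coefD (IH _ _ (fun i => h (widen_ord (leqnSn K) i))) (h ord_max)).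
  by move=> z _; rewrite big_ord_recr.
by rewrite big_ord_recr.
Qed.

Lemma has_coef_sin n k j q :
  has_coef (fun z => r z ^+ n * sin (k%:R * phi z)) j q
    ((j == n) && (q == k))%:R.
Proof.
exists (fun _ _ => 0), (fun n' k' => ((n' == n) && (k' == k))%:R), (maxn n k).+1.
split=> // K z; rewrite gtn_max => /andP[nK kK] _; rewrite /trig_poly.
rewrite (bigD1 (Ordinal nK)) //= (bigD1 (Ordinal kK)) //= !eqxx /=.
rewrite [X in _ = _ + X + _]big1; last first.
  by move=> i; rewrite -val_eqE /= => /negbTE e; rewrite e /=; ring.
rewrite [X in _ = _ + X]big1; first by ring.
move=> i; rewrite -val_eqE /= => /negbTE e; rewrite big1 // => k' _.
by rewrite e /=; ring.
Qed.

(* The points of S allow differentiation in phi. *)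
Hypothesis rotation : forall K al be,
  (forall z, S z -> trig_poly K al be z = 0) ->
  forall z, S z -> trig_poly K (fun n k => k%:R * be n k) (fun n k => - k%:R * al n k) z = 0.
Hypothesis rich : forall p : {poly R}, (forall z, S z -> p.[r z] = 0) -> p = 0.

(** Differentiating twice in phi multiplies the frequency k by - k^2, so every
    polynomial in k^2 may be applied to the coefficients of a vanishing
    expansion; this one kills the frequencies in l. *)
Definition freq_weight (l : seq nat) k : R := \prod_(j <- l) (k%:R ^+ 2 - j%:R ^+ 2).

Lemma trig_poly_weight K al be l : (forall z, S z -> trig_poly K al be z = 0) ->
  forall z, S z -> trig_poly K (fun n k => freq_weight l k * al n k)
                               (fun n k => freq_weight l k * be n k) z = 0.
Proof.
move=> h; elim: l => [|j l IH] z Sz.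
  rewrite -(h z Sz); apply: eq_trig_poly => n k _ _.
  by rewrite /freq_weight big_nil !mul1r.
have h2 := rotation (rotation IH) Sz.
transitivity (-1 * 0 + - j%:R ^+ 2 * 0 : R); last by ring.
rewrite -[in X in _ = -1 * X + _]h2 -[in X in _ = _ + _ * X](IH z Sz) trig_poly_lin.
apply: eq_trig_poly => n k _ _; rewrite /freq_weight big_cons.
by split; ring.
Qed.

(** Killing all frequencies but q, in the expansion and in its phi-derivative,
    leaves two relations at each point, whose combination with sin (q phi) and
    cos (q phi) isolates the sine coefficients: a polynomial in r. *)
Lemma trig_poly_uniq K al be n q : (forall z, S z -> trig_poly K al be z = 0) ->
  (n < K)%N -> (0 < q)%N -> (q < K)%N -> be n q = 0.
Proof.
move=> h nK q0 qK.
pose l := [seq j <- iota 0 K | j != q].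
have w0 k : (k < K)%N -> k != q -> freq_weight l k = 0.
  move=> kK kq; apply/eqP; rewrite prodf_seq_eq0; apply/hasP; exists k; last by rewrite subrr eqxx.
  by rewrite mem_filter kq mem_iota.
have wq : freq_weight l q != 0.
  rewrite prodf_seq_neq0; apply/allP => j; rewrite mem_filter => /andP[jq _] /=.
  rewrite subr_sqr mulf_neq0 //; first by rewrite subr_eq0 eqr_nat eq_sym.
  by rewrite -natrD pnatr_eq0 addn_eq0 negb_and -lt0n q0.
have E a b z : trig_poly K (fun n k => freq_weight l k * a n k)
     (fun n k => freq_weight l k * b n k) z =
   freq_weight l q * \sum_(n < K) (a n q * cos (q%:R * phi z) + b n q * sin (q%:R * phi z)) * r z ^+ n.
  rewrite mulr_sumr; apply: eq_bigr => i _; rewrite (bigD1 (Ordinal qK)) //= big1; first by ring.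
  move=> k; rewrite -val_eqE /= => kq; rewrite w0 //; ring.
have p0 : \poly_(i < K) be i q = 0.
  apply: rich => z Sz; rewrite horner_poly.
  have /eqP := trig_poly_weight l h Sz; rewrite E mulf_eq0 (negbTE wq) /= => /eqP e1.
  have /eqP := trig_poly_weight l (rotation h) Sz; rewrite E mulf_eq0 (negbTE wq) /= => /eqP e2.
  have qR : q%:R != 0 :> R by rewrite pnatr_eq0 -lt0n.
  set s := sin (q%:R * phi z) in e1 e2; set c := cos (q%:R * phi z) in e1 e2.
  transitivity (s * 0 + q%:R^-1 * c * 0 : R); last by ring.
  rewrite -[in X in _ = _ * X + _]e1 -[in X in _ = _ + _ * X]e2 !mulr_sumr -big_split.
  apply: eq_bigr => i _ /=.
  have : c ^+ 2 + s ^+ 2 = 1 := cos2Dsin2 _.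
  move=> cs; transitivity (be i q * (c ^+ 2 + s ^+ 2) * r z ^+ i); first by rewrite cs mulr1.
  by field.
by have := coef_poly K (fun i => be i q) n; rewrite p0 coef0 nK.
Qed.

Lemma has_coef_uniq (F : T -> R) j q b c : (0 < q)%N ->
  has_coef F j q b -> has_coef F j q c -> b = c.
Proof.
move=> q0 [al [be [K1 [h1 <-]]]] [al' [be' [K2 [h2 <-]]]].
pose K := maxn (maxn K1 K2) (maxn j q).+1.
have [k1 k2 jK qK] : [/\ (K1 <= K)%N, (K2 <= K)%N, (j < K)%N & (q < K)%N].
  by split; rewrite /K ?leq_max ?ltnS ?leq_max ?leqnn ?orbT.
have h z : S z -> trig_poly K (fun n k => 1 * al n k + (-1) * al' n k)
    (fun n k => 1 * be n k + (-1) * be' n k) z = 0.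
  by move=> Sz; rewrite -trig_poly_lin -h1 // -h2 // mul1r mulN1r subrr.
have := trig_poly_uniq h jK q0 qK; rewrite mul1r mulN1r => /eqP.
by rewrite subr_eq0 => /eqP.
Qed.

End FiniteExpansions.

(** * Partial Kepler maps *)

Section KeplerMap.
Context {R : realType}.
Variables (m M : R) (A : set R) (V : set (uv R)) (C : coords R -> phase R).
Hypothesis m0 : 0 < m.
Hypothesis M0 : 0 < M.
Hypothesis hC : partial_kepler_map m M A V C.
Hypothesis hu1 : forall z, dom A V z -> z.2.1 0 0 = G2 (C z).
Hypothesis hx1C2 : forall z, dom A V z -> cross (x1 (C z)) (C2 (C z)) != 0.
Hypothesis hC2 : forall z, dom A V z -> C2 (C z) != 0.
Implicit Types (z w : coords R).

Lemma dom_near z : dom A V z -> \forall y \near z, dom A V y.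
Proof.
move=> [Az Vz].
have cfst : {for z, continuous (fun y : coords R => y.1.1)}.
  have c1 : {for z, continuous (fun y : coords R => y.1)} by exact: cvg_fst.
  have c2 : {for z.1, continuous (fun y : R * R => y.1)} by exact: cvg_fst.
  exact: (continuous_comp c1 c2).
have csnd : {for z, continuous (fun y : coords R => y.2)} by exact: cvg_snd.
near=> y; split; near: y.
  by apply: cfst; apply: open_nbhs_nbhs; split => //; exact: (pk_openA hC).
by apply: csnd; apply: open_nbhs_nbhs; split => //; exact: (pk_openV hC).
Unshelve. all: by end_near. Qed.

Section AtPoint.
Variable z : coords R.
Hypothesis Dz : dom A V z.

Local Notation dC := ('d C z).

Lemma dom_diff : differentiable C z.
Proof. exact: (pk_diff hC Dz). Qed.

Lemma x1_neq0 : x1 (C z) != 0.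
Proof. by apply: contraNneq (hx1C2 Dz) => ->; rewrite cross0v. Qed.

Lemma Lam_neq0 : Lam z != 0.
Proof.
apply/eqP => L0; have := pk_bound hC Dz.
by rewrite (pk_energy hC Dz) L0 expr0n /= mulr0 invr0 mulr0 oppr0 ltxx.
Qed.

Lemma dC_surj q : exists w : coords R, dC w = q.
Proof. by apply: symplectic_surj => a b; exact: (pk_symplectic hC). Qed.

Lemma diff_id_coords w : 'd id z w = w.
Proof. by have /(congr1 (@^~ w)) := @diff_val _ _ _ _ _ _ _ (is_diff_id z). Qed.

Lemma has_diff_Lam : has_diff (fun y : coords R => Lam y) z (fun w => w.1.1).
Proof.
have [d1 e1] := @diff_fst _ _ (R * R)%type (uv R) id z ex_diff.
have [d2 e2] := diff_fst d1.
by split=> // w; rewrite e2 e1 diff_id_coords.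
Qed.

Lemma has_diff_u1 : has_diff (fun y : coords R => y.2.1 0 0) z (fun w => w.2.1 0 0).
Proof.
have [d1 e1] := @diff_snd _ _ (R * R)%type (uv R) id z ex_diff.
have [d2 e2] := diff_fst d1.
apply: (has_diff_eq (has_diff_entry 0 d2)) => w.
by rewrite e2 e1 diff_id_coords.
Qed.

Lemma Lam_dir w : w.1.1 * (m ^+ 3 * M ^+ 2 / Lam z ^+ 3) = denergy m M (C z) (dC w).
Proof.
have L0 := Lam_neq0.
have h1 := has_diff_energy M dom_diff (hC2 Dz) (lt0r_neq0 m0).
have h2 : has_diff (fun y => - (m ^+ 3 * M ^+ 2 / (2 * Lam y ^+ 2))) z
   (fun w => w.1.1 * (m ^+ 3 * M ^+ 2 / Lam z ^+ 3)).
  apply: has_diff_eq.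
    apply: has_diffN; apply: has_diffZ; apply: has_diffV; last first.
      by apply: has_diffZ; apply: has_diffX; exact: has_diff_Lam.
    by rewrite mulf_neq0 ?expf_neq0 ?pnatr_eq0.
  by move=> w' /=; field.
have h3 : has_diff (fun y => - (m ^+ 3 * M ^+ 2 / (2 * Lam y ^+ 2))) z
   (fun w => denergy m M (C z) (dC w)).
  apply: has_diff_near h1.
  by apply: filterS (dom_near Dz) => y Dy; rewrite (pk_energy hC Dy).
exact: has_diff_unique h2 h3 w.
Qed.

Lemma G2_dir w : w.2.1 0 0 = dG2 (C z) (dC w).
Proof.
have h1 := has_diff_G2 dom_diff (hC2 Dz).
have h2 := has_diff_u1.
apply: (has_diff_unique h2 (k := fun w => dG2 (C z) (dC w))); apply: has_diff_near h1.
by apply: filterS (dom_near Dz) => y Dy; rewrite hu1.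
Qed.

Lemma denergy0_Lam w : denergy m M (C z) (dC w) = 0 -> w.1.1 = 0.
Proof.
rewrite -Lam_dir => /eqP; rewrite mulf_eq0 => /orP[/eqP//|].
by rewrite mulf_eq0 invr_eq0 !(expf_eq0, mulf_eq0) /= (negbTE Lam_neq0) !gt_eqF.
Qed.

(** G is the coordinate u_1, so its Hamiltonian field in coordinates is - ev 0. *)
Lemma dC_ev0 : dC (ev 0) = spin (C z).
Proof.
apply: phase_form_inj => q; have [a <-] := dC_surj q.
rewrite (pk_symplectic hC) // spinP -G2_dir /coords_form /=.
rewrite (bigD1 0) //= big1 ?mxE /=; first by rewrite ?mxE; ring.
by move=> j /negbTE j0; rewrite !mxE j0 /=; ring.
Qed.

Local Notation XB := (Xham (fun y => x1_lrl m M (C y)) z).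

Let hB := has_diff_x1_lrl m M dom_diff (hC2 Dz).

Lemma dC_XhamB : dC XB = x1_lrl_field m M (C z).
Proof.
apply: phase_form_inj => q; have [a <-] := dC_surj q.
rewrite (pk_symplectic hC) // x1_lrl_fieldP coords_form_Xham; last by have [] := hB.
by have [_ ->] := hB.
Qed.

Definition tangent w := w.1.1 = 0 /\ dTheta (C z) (dC w) = 0.

Lemma tangent_XhamB : tangent XB.
Proof.
split; last by rewrite dC_XhamB dTheta_x1_lrl_field.
apply: denergy0_Lam; rewrite dC_XhamB denergy_x1_lrl_field ?lt0r_neq0 //.
exact: C2_x2_neq0 (hC2 Dz).
Qed.

Lemma XhamB_u1 : XB.2.1 0 0 = x1_lrl_perp m M (C z).
Proof. by rewrite G2_dir dC_XhamB dG2_x1_lrl_field. Qed.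

Lemma tangent_ev0 : tangent (ev 0).
Proof. by split=> //; rewrite dC_ev0 dTheta_spin. Qed.

Lemma ev0_u1 : (ev 0 : coords R).2.1 0 0 = 0.
Proof. by rewrite mxE. Qed.

(** Moving x1 alone changes neither the Kepler energy nor G. *)
Lemma x1_dir (v : 'rV[R]_3) : exists w : coords R, [/\ w.1.1 = 0, w.2.1 0 0 = 0 &
  dC w = ((0, 0), (v, 0))].
Proof.
have [w wE] := dC_surj ((0, 0), (v, 0)); exists w; split => //.
  apply: denergy0_Lam; rewrite wE /denergy /y2 /x2 /=.
  by rewrite !(dotC _ 0) !dot0v mulr0 !mul0r addr0.
by rewrite G2_dir wE /dG2 /dC2 /y2 /x2 /= cross0v crossv0 addr0 dotC dot0v mul0r.
Qed.

(** The velocity C2 of x1 changes Theta at the rate |cross x1 C2|^2 / rho^3. *)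
Lemma Theta_dir : exists e : coords R, [/\ e.1.1 = 0, e.2.1 0 0 = 0 & dTheta (C z) (dC e) != 0].
Proof.
have [e [e1 e2 eE]] := x1_dir (C2 (C z)); exists e; split => //.
have r0 : rho (C z) != 0 by rewrite lt0r_neq0 // rho_gt0 // x1_neq0.
rewrite eE /dTheta /dC2 /y2 /x2 /x1 /= cross0v crossv0 addr0 (dotC _ 0) dot0v addr0.
have -> : dot (C2 (C z)) (C2 (C z)) / rho (C z)
  - dot (C z).2.1 (C2 (C z)) * dot (C z).2.1 (C2 (C z)) / rho (C z) ^+ 3 =
  dot (cross (x1 (C z)) (C2 (C z))) (cross (x1 (C z)) (C2 (C z))) / rho (C z) ^+ 3.
  by rewrite dot_cross_cross -(enorm_sqr (x1 _)) -/(rho _) /x1; field.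
by rewrite mulf_neq0 ?dot_eq0 ?hx1C2 // invr_eq0 expf_neq0.
Qed.

(** Dilate x1: Theta is homogeneous of degree 0 in x1, and rho of degree 1. *)
Lemma tangent_rho : exists w : coords R, [/\ tangent w, w.2.1 0 0 = 0 & drho (C z) (dC w) = rho (C z)].
Proof.
have r0 : rho (C z) != 0 by rewrite lt0r_neq0 // rho_gt0 // x1_neq0.
have [w [w1 w2 wE]] := x1_dir (x1 (C z)); exists w; split => //.
  split=> //; rewrite wE /dTheta /dC2 /y2 /x2 /x1 /= cross0v crossv0 addr0 (dotC _ 0) dot0v addr0.
  by rewrite -[dot (C z).2.1 (C z).2.1]enorm_sqr -/(rho _); field.
by rewrite wE /drho {2}/x1 /= -enorm_sqr -/(rho _); field.
Qed.

End AtPoint.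

Lemma dom_near0 z : dom A V z -> \forall h \near (0 : coords R), dom A V (z + h).
Proof.
move=> Dz; have := dom_near Dz; rewrite (near_shift 0 z) subr0.
by apply: filterS => h /=; rewrite addrC.
Qed.

Lemma Theta_continuous_near z : dom A V z ->
  \forall h \near (0 : coords R), {for z + h, continuous (fun y => Theta (C y))}.
Proof.
move=> Dz; apply: filterS (dom_near0 Dz) => h Dy.
apply: differentiable_continuous.
by have [] := has_diff_Theta (dom_diff Dy) (x1_neq0 Dy).
Qed.

(** [level_set_derive] for T = Theta, with e the direction of [Theta_dir]. Since
    Lambda and G are coordinates, they are affine along z + t w + s e, and e does
    not change them. *)
Lemma slice_derive z f df w (phi : R -> R) : dom A V z -> has_diff f z df ->
  tangent z w ->
  (forall y t, dom A V y -> Lam y = Lam z -> Theta (C y) = Theta (C z) ->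
     G2 (C y) = G2 (C z) + t * w.2.1 0 0 -> f y = phi t) ->
  is_derive (0 : R) 1 phi (df w).
Proof.
move=> Dz hf [w1 wT] hphi.
have [e [e1 e2 eT]] := Theta_dir Dz.
have hT := has_diff_Theta (dom_diff Dz) (x1_neq0 Dz).
apply: (level_set_derive (Theta_continuous_near Dz) hT eT wT hf).
apply: filterS (dom_near0 Dz) => h Dh s t hE TE; apply: hphi => //.
  by rewrite hE /Lam /= w1 e1 !scaler0 !addr0.
by rewrite -!hu1 // hE /= !mxE e2 mulr0 addr0.
Qed.

(** H is not assumed to be differentiable: if w moves G, the derivative of H is
    obtained from that of f; otherwise both sides vanish, whatever H is. *)
Lemma slice_derive_G z f df w (H : R -> R) : dom A V z -> has_diff f z df ->
  tangent z w ->
  (forall y, dom A V y -> Lam y = Lam z -> Theta (C y) = Theta (C z) ->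
     f y = H (G2 (C y))) ->
  df w = w.2.1 0 0 * 'D_1 H (G2 (C z)).
Proof.
move=> Dz hf tw hH; set c := w.2.1 0 0.
have hd : is_derive (0 : R) 1 (fun t => H (G2 (C z) + t * c)) (df w).
  by apply: (slice_derive Dz hf tw) => y t Dy L T <-; exact: hH.
have [c0|c0] := eqVneq c 0.
  rewrite c0 mul0r; have [_ <-] := hd; rewrite c0.
  by under eq_fun do rewrite mulr0 addr0; rewrite derive_cst.
set G := G2 (C z) in hd *.
have ha : is_derive G 1 (fun x : R => c^-1 * (x - G)) (c^-1).
  have h := is_deriveZ (c^-1) (is_deriveB (is_derive_id G 1) (is_derive_cst G G 1)).
  by apply: (@is_derive_eq _ _ _ _ _ _ _ _ h); rewrite subr0 /GRing.scale /= mulr1.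
have hd' : is_derive (c^-1 * (G - G)) 1 (fun t => H (G + t * c)) (df w).
  by rewrite subrr mulr0.
have [_] := is_derive1_comp (g := fun x : R => c^-1 * (x - G)) hd' ha.
have -> : (fun t => H (G + t * c)) \o (fun x : R => c^-1 * (x - G)) = H.
  by apply/funext => x /=; congr H; field.
by move=> ->; field.
Qed.

(** * Leaves of constant Lambda, G and Theta *)

Definition leaf z y := [/\ dom A V y, Lam y = Lam z, G2 (C y) = G2 (C z) &
  Theta (C y) = Theta (C z)].

Lemma leaf_derive z f df w a : dom A V z -> has_diff f z df ->
  tangent z w -> w.2.1 0 0 = 0 -> (forall y, leaf z y -> f y = a) -> df w = 0.
Proof.
move=> Dz hf tw w0 hH.
have [_ <-] : is_derive (0 : R) 1 (fun=> a) (df w).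
  apply: (slice_derive Dz hf tw) => y t Dy L T; rewrite w0 mulr0 addr0 => G.
  by apply: hH.
exact: derive_cst.
Qed.

Lemma leaf_trans z y x : leaf z y -> leaf y x -> leaf z x.
Proof. by move=> [D1 L1 G1 T1] [D2' L2 G2' T2]; split; congruence. Qed.

(** The derivative of p (rho) along the dilation of x1 is p' (rho) rho, so p'
    vanishes on the leaf with p. By induction on the degree p' = 0, so p is
    constant, and vanishes at z. *)
Lemma leaf_rho_poly z (p : {poly R}) : dom A V z ->
  (forall y, leaf z y -> p.[rho (C y)] = 0) -> p = 0.
Proof.
move=> Dz; have [n] := ubnP (size p); elim: n p => // n IH p sp hp.
have [//|p0] := eqVneq p 0.
have p'0 : p^`() = 0.
  apply: IH; first by rewrite (leq_trans (lt_size_deriv p0)).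
  move=> y ly; have [Dy _ _ _] := ly.
  have [w [tw w0 wr]] := tangent_rho Dy.
  have hr := has_diff_rho (dom_diff Dy) (x1_neq0 Dy).
  have hp' := has_diff_comp (f := fun x => rho (C x)) (is_derive_poly p (rho (C y))) hr.
  have := leaf_derive Dy hp' tw w0 (fun x lx => hp x (leaf_trans ly lx)).
  rewrite wr => /eqP; rewrite mulf_eq0 => /orP[/eqP//|].
  by rewrite gt_eqF // rho_gt0 // (x1_neq0 Dy).
have pc : p = (p`_0)%:P.
  apply: size1_polyC; rewrite leqNgt; apply/negP => s1.
  have : p^`()`_(size p).-2 = 0 by rewrite p'0 coef0.
  rewrite coef_deriv => /eqP; rewrite mulrn_eq0 /=.
  have -> : (size p).-2.+1 = (size p).-1 by case: (size p) s1 => [|[]].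
  by rewrite -lead_coefE lead_coef_eq0 -size_poly_eq0; case: (size p) s1.
have := hp z; rewrite {1}pc hornerC => p00.
by rewrite pc p00.
Qed.


(** * The angle phi *)

Variable P : phase R -> 'rV[R]_3.
Hypothesis hP : forall z, dom A V z -> perihelion_direction m M (C z) (P (C z)).
Hypothesis hC2P : forall z, dom A V z -> cross (C2 (C z)) (P (C z)) != 0.

Let lam z := m ^+ 2 * M * ecc (Lam z) (C z).

Lemma ecc_gt0 z : dom A V z -> 0 < ecc (Lam z) (C z).
Proof. by move=> Dz; rewrite lt_neqAle eq_sym (pk_ecc hC Dz) sqrtr_ge0. Qed.

Lemma ecc_arg_gt0 z : dom A V z -> 0 < 1 - G2 (C z) ^+ 2 / Lam z ^+ 2.
Proof. by move=> Dz; rewrite -sqrtr_gt0 ecc_gt0. Qed.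

Lemma enorm_Lrl z : dom A V z -> enorm (Lrl m M (C z)) = lam z.
Proof.
move=> Dz; have L0 := Lam_neq0 Dz.
have l0 : 0 < lam z by rewrite /lam !mulr_gt0 ?exprn_gt0 ?ecc_gt0.
apply/eqP; rewrite -(@eqrXn2 _ 2) ?enorm_ge0 ?(ltW l0) //; apply/eqP.
rewrite enorm_lrl ?(C2_x2_neq0 (hC2 Dz)) //.
have := pk_energy hC Dz; rewrite /kepler_energy => ->.
rewrite -/(C2 (C z)) -/(G2 (C z)) /lam [RHS]exprMn.
have -> : ecc (Lam z) (C z) ^+ 2 = 1 - G2 (C z) ^+ 2 / Lam z ^+ 2.
  by rewrite sqr_sqrtr // ltW // ecc_arg_gt0.
by field.
Qed.

Lemma Lrl_perihelion z : dom A V z ->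
  enorm (P (C z)) = 1 /\ Lrl m M (C z) = lam z *: P (C z).
Proof.
move=> Dz; have [_ P1 LP] := lrl_perihelion m0 (hP Dz).
by split=> //; rewrite -enorm_Lrl.
Qed.

Lemma E0E z : dom A V z -> E0 C P m M z = G2 (C z) ^+ 2 - x1_lrl m M (C z).
Proof.
by move=> Dz; rewrite /E0 /x1_lrl; have [_ ->] := Lrl_perihelion Dz; rewrite dotZr.
Qed.

Lemma enorm_x1C2 z : dom A V z ->
  enorm (cross (x1 (C z)) (C2 (C z))) = rho (C z) * Num.sqrt (G2 (C z) ^+ 2 - Theta (C z) ^+ 2).
Proof.
move=> Dz; have r0 := rho_gt0 (x1_neq0 Dz).
rewrite /enorm dot_cross_cross -!enorm_sqr -/(rho _) -/(G2 _).
have -> : dot (x1 (C z)) (C2 (C z)) = rho (C z) * Theta (C z).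
  by rewrite /Theta -/(rho _); field; rewrite lt0r_neq0.
rewrite exprMn -mulrBr sqrtrM ?sqr_ge0 //.
by rewrite sqrtr_sqr gtr0_norm.
Qed.

Lemma Theta_arg_gt0 z : dom A V z -> 0 < G2 (C z) ^+ 2 - Theta (C z) ^+ 2.
Proof.
move=> Dz; have r0 := rho_gt0 (x1_neq0 Dz).
have : 0 < enorm (cross (x1 (C z)) (C2 (C z))) by rewrite enorm_gt0 hx1C2.
by rewrite enorm_x1C2 // pmulr_rgt0 // sqrtr_gt0.
Qed.

(** The inverse of m^2 M ecc sqrt (1 - Theta^2 / G^2), the amplitude of
    B / rho as a function of phi. *)
Definition tau_of (L G T : R) :=
  G / (m ^+ 2 * M * Num.sqrt (1 - G ^+ 2 / L ^+ 2) * Num.sqrt (G ^+ 2 - T ^+ 2)).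

Definition tau z := tau_of (Lam z) (G2 (C z)) (Theta (C z)).

Lemma tau_gt0 z : dom A V z -> 0 < tau z.
Proof.
move=> Dz; rewrite /tau /tau_of divr_gt0 ?(G2_gt0 (hC2 Dz)) //.
by rewrite !mulr_gt0 ?exprn_gt0 // sqrtr_gt0 ?ecc_arg_gt0 ?Theta_arg_gt0.
Qed.

Lemma C2P_perp z : dom A V z -> dot (C2 (C z)) (P (C z)) = 0.
Proof.
move=> Dz; have := lrl_perp m M (y2 (C z)) (x2 (C z)).
rewrite -/(Lrl m M (C z)) -/(C2 _); have [_ ->] := Lrl_perihelion Dz.
move/eqP; rewrite dotZr mulf_eq0 /lam gt_eqF; first by move=> /eqP.
by rewrite !mulr_gt0 ?exprn_gt0 ?ecc_gt0.
Qed.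

Lemma enorm_C2P z : dom A V z -> enorm (cross (C2 (C z)) (P (C z))) = G2 (C z).
Proof.
move=> Dz; have [P1 _] := Lrl_perihelion Dz.
rewrite /enorm dot_cross_cross C2P_perp // expr0n subr0 -!enorm_sqr P1 expr1n mulr1.
by rewrite sqrtr_sqr ger0_norm // enorm_ge0.
Qed.

Lemma cos_phiC z : dom A V z ->
  cos (phiC C P z) = - (x1_lrl m M (C z) * (tau z / rho (C z))).
Proof.
move=> Dz; rewrite /phiC /phi (cos_oriented_angle _ (hx1C2 Dz) (hC2P Dz)).
have r0 := lt0r_neq0 (rho_gt0 (x1_neq0 Dz)).
have g0 := lt0r_neq0 (G2_gt0 (hC2 Dz)).
have s0 := Theta_arg_gt0 Dz; rewrite -sqrtr_gt0 in s0; have {}s0 := lt0r_neq0 s0.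
have e0 := lt0r_neq0 (ecc_gt0 Dz); have mn0 := lt0r_neq0 m0; have Mn0 := lt0r_neq0 M0.
rewrite enorm_x1C2 // enorm_C2P // /x1_lrl; have [_ ->] := Lrl_perihelion Dz.
rewrite dotZr.
have -> : dot (cross (x1 (C z)) (C2 (C z))) (cross (C2 (C z)) (P (C z))) =
   dot (x1 (C z)) (C2 (C z)) * dot (C2 (C z)) (P (C z)) -
   dot (x1 (C z)) (P (C z)) * dot (C2 (C z)) (C2 (C z)).
  by move: (x1 _) (C2 _) (P _) => a b c; coord; ring.
rewrite C2P_perp // -enorm_sqr -/(G2 _) /tau /tau_of /lam -/(ecc _ _).
by field; rewrite r0 g0 s0 e0 mn0 Mn0.
Qed.

Lemma sin_phiC z : dom A V z ->
  sin (phiC C P z) = x1_lrl_perp m M (C z) * (tau z / rho (C z)).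
Proof.
move=> Dz.
have perp1 (a b : 'rV[R]_3) : dot b (cross a b) = 0 by coord; ring.
have perp2 (a b : 'rV[R]_3) : dot b (cross b a) = 0 by coord; ring.
rewrite /phiC /phi (sin_oriented_angle (hx1C2 Dz) (hC2P Dz) (hC2 Dz)) ?perp1 ?perp2 //.
have r0 := lt0r_neq0 (rho_gt0 (x1_neq0 Dz)).
have g0 := lt0r_neq0 (G2_gt0 (hC2 Dz)).
have s0 := Theta_arg_gt0 Dz; rewrite -sqrtr_gt0 in s0; have {}s0 := lt0r_neq0 s0.
have e0 := lt0r_neq0 (ecc_gt0 Dz); have mn0 := lt0r_neq0 m0; have Mn0 := lt0r_neq0 M0.
rewrite enorm_x1C2 // enorm_C2P // /x1_lrl_perp; have [_ ->] := Lrl_perihelion Dz.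
rewrite crossZr dotZr.
have -> : dot (C2 (C z)) (cross (cross (x1 (C z)) (C2 (C z))) (cross (C2 (C z)) (P (C z)))) =
   dot (C2 (C z)) (C2 (C z)) * dot (x1 (C z)) (cross (C2 (C z)) (P (C z))).
  by move: (x1 _) (C2 _) (P _) => a b c; coord; ring.
rewrite -enorm_sqr -/(G2 _) /tau /tau_of /lam -/(ecc _ _).
by field; rewrite r0 g0 s0 e0 mn0 Mn0.
Qed.


Local Notation XB z := (Xham (fun y => x1_lrl m M (C y)) z).

Lemma has_diff_tau z : dom A V z -> exists dtau, has_diff tau z dtau.
Proof.
move=> Dz; have dC := dom_diff Dz.
have hL := has_diff_Lam z; have hG := has_diff_G2 dC (hC2 Dz).
have hT := has_diff_Theta dC (x1_neq0 Dz).
have L0 := Lam_neq0 Dz; have e0 := ecc_arg_gt0 Dz; have s0 := Theta_arg_gt0 Dz.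
eexists; rewrite /tau /tau_of; apply: has_diffM; first exact: hG.
apply: has_diffV.
  by rewrite !mulf_neq0 ?expf_neq0 ?gt_eqF ?sqrtr_gt0.
apply: has_diffM.
  apply: has_diffZ; apply: has_diff_sqrt => //.
  apply: has_diffB; first exact: has_diff_cst.
  apply: has_diffM; first exact: has_diffX hG.
  by apply: has_diffV; [rewrite expf_neq0|exact: has_diffX hL].
apply: has_diff_sqrt => //.
by apply: has_diffB; [exact: has_diffX hG|exact: has_diffX hT].
Qed.

(** Along the field of B the angle phi moves at speed - omega rho cos phi. *)
Definition omega (L G T : R) :=
  'D_1 (fun g => tau_of L g T) G / tau_of L G T ^+ 2.

(** The bracket of a function with itself. *)
Lemma dx1_lrl_field p : dx1_lrl m M p (x1_lrl_field m M p) = 0.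
Proof.
rewrite -x1_lrl_fieldP /phase_form.
by rewrite !subrr addr0.
Qed.

Lemma has_diff_cos_phiC z : dom A V z ->
  exists2 dc, has_diff (fun y => cos (phiC C P y)) z dc &
    dc (ev 0) = -1 * sin (phiC C P z) /\
    dc (XB z) = omega (Lam z) (G2 (C z)) (Theta (C z)) * rho (C z) *
      cos (phiC C P z) * sin (phiC C P z).
Proof.
move=> Dz; have [dtau ht] := has_diff_tau Dz.
have hB := has_diff_x1_lrl m M (dom_diff Dz) (hC2 Dz).
have hr := has_diff_rho (dom_diff Dz) (x1_neq0 Dz).
have r0 := lt0r_neq0 (rho_gt0 (x1_neq0 Dz)).
have t0 := lt0r_neq0 (tau_gt0 Dz).
have hc := has_diffN (has_diffM hB (has_diffM ht (has_diffV (f := fun y => rho (C y)) r0 hr))).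
have ev_u1 : (ev 0 : coords R).2.1 0 0 = 0 := ev0_u1.
have te : dtau (ev 0) = 0.
  apply: (leaf_derive Dz ht (tangent_ev0 Dz) ev_u1 (a := tau z)) => y [_ L G T].
  by rewrite /tau L G T.
have tB : dtau (XB z) = x1_lrl_perp m M (C z) *
    'D_1 (fun g => tau_of (Lam z) g (Theta (C z))) (G2 (C z)).
  rewrite -(XhamB_u1 Dz); apply: (slice_derive_G Dz ht (tangent_XhamB Dz)) => y Dy L T.
  by rewrite /tau L T.
eexists; first apply: has_diff_near hc.
  by apply: filterS (dom_near Dz) => y Dy; rewrite cos_phiC.
rewrite /= sin_phiC // cos_phiC //.
rewrite te tB (dC_ev0 Dz) (dC_XhamB Dz) drho_spin drho_x1_lrl_field dx1_lrl_spin dx1_lrl_field; split.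
  by field.
rewrite /omega -/(tau z); move: ('D_(1 : R) (fun g => _) _) (x1_lrl_perp _ _ _) (x1_lrl _ _ _) => a b c.
by field; rewrite r0 t0.
Qed.

Lemma has_diff_sin_phiC z : dom A V z ->
  exists2 ds, has_diff (fun y => sin (phiC C P y)) z ds &
    ds (ev 0) = - -1 * cos (phiC C P z).
Proof.
move=> Dz; have [dtau ht] := has_diff_tau Dz.
have hS := has_diff_x1_lrl_perp m M (dom_diff Dz) (hC2 Dz).
have hr := has_diff_rho (dom_diff Dz) (x1_neq0 Dz).
have r0 := lt0r_neq0 (rho_gt0 (x1_neq0 Dz)).
have hc := has_diffM hS (has_diffM ht (has_diffV (f := fun y => rho (C y)) r0 hr)).
have ev_u1 : (ev 0 : coords R).2.1 0 0 = 0 := ev0_u1.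
have te : dtau (ev 0) = 0.
  apply: (leaf_derive Dz ht (tangent_ev0 Dz) ev_u1 (a := tau z)) => y [_ L G T].
  by rewrite /tau L G T.
eexists; first apply: has_diff_near hc.
  by apply: filterS (dom_near Dz) => y Dy; rewrite sin_phiC.
rewrite /= cos_phiC // te (dC_ev0 Dz) drho_spin dx1_lrl_perp_spin ?hC2 //.
by field.
Qed.

Lemma drho_ev0 z : dom A V z -> drho (C z) ('d C z (ev 0)) = 0.
Proof. by move=> Dz; rewrite dC_ev0 // drho_spin. Qed.

(** The derivative along ev 0, which is tangent to the leaf; it turns phi at unit
    speed and fixes rho. *)
Lemma leaf_rotation z K al be : dom A V z ->
  (forall y, leaf z y -> trig_poly (phiC C P) (rhoC C) K al be y = 0) ->
  forall y, leaf z y ->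
    trig_poly (phiC C P) (rhoC C) K (fun n k => k%:R * be n k)
      (fun n k => - k%:R * al n k) y = 0.
Proof.
move=> Dz h y ly; have [Dy _ _ _] := ly.
have [dc hc [dce _]] := has_diff_cos_phiC Dy.
have [ds hs dse] := has_diff_sin_phiC Dy.
have hr := has_diff_rho (dom_diff Dy) (x1_neq0 Dy).
have hcs k := cid2 (has_diff_cosk hc k).
have hss k := cid2 (has_diff_sink hc hs k).
pose dck k := s2val (hcs k); pose dsk k := s2val (hss k).
have hck k : has_diff (fun x => cos (k%:R * phiC C P x)) y (dck k) := s2valP (hcs k).
have hsk k : has_diff (fun x => sin (k%:R * phiC C P x)) y (dsk k) := s2valP (hss k).
have eck k : dck k (ev 0) = -1 * k%:R * sin (k%:R * phiC C P y) := s2valP' (hcs k) _ _ dce.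
have esk k : dsk k (ev 0) = - -1 * k%:R * cos (k%:R * phiC C P y) := s2valP' (hss k) _ _ dce dse.
have hF : has_diff (trig_poly (phiC C P) (rhoC C) K al be) y
  (fun w => \sum_(n < K) \sum_(k < K)
    ((al n k * cos (k%:R * phiC C P y) + be n k * sin (k%:R * phiC C P y)) *
       (n%:R * rho (C y) ^+ n.-1 * drho (C y) ('d C y w)) +
     rho (C y) ^+ n * (al n k * dck k w + be n k * dsk k w))).
  apply: has_diff_sum => n; apply: has_diff_sum => k.
  apply: has_diffM; last exact: has_diffX hr.
  by apply: has_diffD; apply: has_diffZ.
have ev_u1 : (ev 0 : coords R).2.1 0 0 = 0 := ev0_u1.
have <- := leaf_derive Dy hF (tangent_ev0 Dy) ev_u1 (fun x lx => h x (leaf_trans ly lx)).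
apply: eq_bigr => n _; apply: eq_bigr => k _.
by rewrite drho_ev0 // eck esk /rhoC; ring.
Qed.

Lemma leaf_coef_uniq z F j q b c : dom A V z -> (0 < q)%N ->
  has_coef (leaf z) (phiC C P) (rhoC C) F j q b ->
  has_coef (leaf z) (phiC C P) (rhoC C) F j q c -> b = c.
Proof.
move=> Dz; apply: has_coef_uniq => [K al be h y ly|p hp].
  exact: leaf_rotation h y ly.
exact: leaf_rho_poly hp.
Qed.

Lemma has_diff_E0 z : dom A V z -> has_diff (E0 C P m M) z
  (fun w => 2 * G2 (C z) * dG2 (C z) ('d C z w) - dx1_lrl m M (C z) ('d C z w)).
Proof.
move=> Dz.
have hG := has_diff_G2 (dom_diff Dz) (hC2 Dz).
have hB := has_diff_x1_lrl m M (dom_diff Dz) (hC2 Dz).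
apply: has_diff_near (has_diffB (has_diffX 2 hG) hB).
by apply: filterS (dom_near Dz) => y Dy; rewrite E0E.
Qed.

Lemma Xham_E0 z : dom A V z ->
  Xham (E0 C P m M) z = - (2 * G2 (C z)) *: ev 0 - XB z.
Proof.
move=> Dz; have [dE dEE] := has_diff_E0 Dz.
have [dB dBE] := has_diff_x1_lrl m M (dom_diff Dz) (hC2 Dz).
apply/subr0_eq/coords_form_inj => a.
have h1 := coords_form_Xham a dE; have h2 := coords_form_Xham a dB.
rewrite dEE in h1; rewrite dBE in h2.
have h3 : coords_form (ev 0) a = - dG2 (C z) ('d C z a).
  by rewrite -(pk_symplectic hC (ev 0) a Dz) dC_ev0 // spinP.
have lin (x y u : coords R) s : coords_form (x - (s *: y - u)) a =
    coords_form x a - s * coords_form y a + coords_form u a.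
  rewrite /coords_form.
  have -> : \sum_(i < 5) ((x - (s *: y - u)).2.1 0 i * a.2.2 0 i -
       a.2.1 0 i * (x - (s *: y - u)).2.2 0 i) =
    \sum_(i < 5) (x.2.1 0 i * a.2.2 0 i - a.2.1 0 i * x.2.2 0 i) -
    s * \sum_(i < 5) (y.2.1 0 i * a.2.2 0 i - a.2.1 0 i * y.2.2 0 i) +
    \sum_(i < 5) (u.2.1 0 i * a.2.2 0 i - a.2.1 0 i * u.2.2 0 i).
    rewrite mulr_sumr -sumrB -big_split; apply: eq_bigr => i _.
    by rewrite /= !mxE; ring.
  move: (\sum_(i < 5) (x.2.1 0 i * _ - _)) (\sum_(i < 5) (y.2.1 0 i * _ - _)) => b c.
  move: (\sum_(i < 5) _) => d.
  case: x => [[x1 x2] x3]; case: y => [[y1 y2] y3]; case: u => [[u1 u2] u3].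
  rewrite /= /GRing.scale /=; ring.
by rewrite lin h1 h2 h3; ring.
Qed.


(** * The coefficients of the bracket with E0 *)

Section Expansion.
Variable h : nat -> nat -> R * uv R -> R.
Hypothesis hdiff : forall n k z, dom A V z -> differentiable (h n k) (Luv z).
Hypothesis hdep : forall n k, exists H : R -> R -> R -> R, forall z, dom A V z ->
  h n k (Luv z) = H (Lam z) (G2 (C z)) (Theta (C z)).
Hypothesis hdep0 : forall k, exists H : R -> R -> R, forall z, dom A V z ->
  h 0%N k (Luv z) = H (Lam z) (Theta (C z)).

Local Notation X_at z := (Xham (E0 C P m M) z).
Local Notation phiC := (phiC C P).
Local Notation rhoC := (rhoC C).

Definition term n k (z : coords R) : R :=
  h n k (Luv z) * rhoC z ^+ n * cos (k%:R * phiC z).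

Lemma has_diff_h n k z : dom A V z ->
  has_diff (fun y => h n k (Luv y)) z ('d (fun y => h n k (Luv y)) z).
Proof.
move=> Dz; split=> //.
have [d1 _] := @diff_fst _ _ (R * R)%type (uv R) id z ex_diff.
have [d2 _] := @diff_snd _ _ (R * R)%type (uv R) id z ex_diff.
have [d3 _] := diff_fst d1.
have dL : differentiable (Luv : coords R -> R * uv R) z := differentiable_pair d3 d2.
exact: (differentiable_comp (g := h n k) dL (hdiff n k Dz)).
Qed.

Lemma dh_ev0 n k z : dom A V z -> 'd (fun y => h n k (Luv y)) z (ev 0) = 0.
Proof.
move=> Dz; have [H hH] := hdep n k.
apply: (leaf_derive Dz (has_diff_h n k Dz) (tangent_ev0 Dz) ev0_u1 (a := h n k (Luv z))).
by move=> y [Dy L G T]; rewrite !hH // L G T.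
Qed.

(** The summands come from the motion of phi under G^2, and from those of G and of
    phi under B. *)
Lemma has_diff_term n k z : dom A V z ->
  exists2 l, has_diff (term n k) z l & l (X_at z) =
   2 * G2 (C z) * k%:R * h n k (Luv z) * (rhoC z ^+ n * sin (k%:R * phiC z))
   - 'd (fun y => h n k (Luv y)) z (XB z) * (rhoC z ^+ n * cos (k%:R * phiC z))
   - h n k (Luv z) * k%:R * omega (Lam z) (G2 (C z)) (Theta (C z)) *
     (rhoC z ^+ n.+1 * (sin (k%:R * phiC z) * cos (phiC z))).
Proof.
move=> Dz; have [dc hc [dce dcB]] := has_diff_cos_phiC Dz.
have [dck hck e] := has_diff_cosk hc k.
have hr := has_diff_rho (dom_diff Dz) (x1_neq0 Dz).
have hh := has_diff_h n k Dz.
have ht := has_diffM (has_diffM hh (has_diffX n hr)) hck.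
eexists; first exact: ht.
have lin := has_diff_linear (- (2 * G2 (C z))) (-1) (ev 0) (XB z) ht.
have -> : X_at z = - (2 * G2 (C z)) *: ev 0 + -1 *: XB z by rewrite Xham_E0 // scaleN1r.
rewrite {}lin.
rewrite (dh_ev0 n k Dz) (e _ _ dce) (e _ _ dcB) (dC_ev0 Dz) (dC_XhamB Dz).
rewrite drho_spin drho_x1_lrl_field.
rewrite /rhoC exprS; move: ('d _ z (XB z)) (omega _ _ _) (h n k _) => b o f.
by rewrite /Defs.rhoC; ring.
Qed.

Lemma poisson_partial_sum N z : dom A V z ->
  poisson (partial_sum C P h N) (E0 C P m M) z =
  \sum_(n < N) \sum_(k < N) poisson (term n k) (E0 C P m M) z.
Proof.
move=> Dz.
have hs : has_diff (partial_sum C P h N) z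
    (fun w => \sum_(n < N) \sum_(k < N) 'd (term n k) z w).
  apply: has_diff_sum => n; apply: has_diff_sum => k.
  by have [l [d _] _] := has_diff_term n k Dz; split.
rewrite poissonE; last by have [] := hs.
have [_ ->] := hs; apply: eq_bigr => n _; apply: eq_bigr => k _.
by rewrite poissonE //; have [l [d _] _] := has_diff_term n k Dz.
Qed.

Lemma has_coef_sin_cos z0 n k j q : (j != n) || (k.+1 < q)%N ->
  has_coef (leaf z0) phiC rhoC
    (fun z => rhoC z ^+ n * (sin (phiC z) * cos (k%:R * phiC z))) j q 0.
Proof.
have coef0 k' : (j != n) || (k' < q)%N -> (j == n) && (q == k') = false.
  by case: (j == n) => //= lt; rewrite gtn_eqF.
case: k => [|k] hjq.
  apply: has_coef_eq (has_coef_sin (leaf z0) phiC rhoC n 1 j q); last by rewrite coef0.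
  by move=> z _; rewrite mul0r cos0 mulr1 mul1r.
have c2 := has_coef_sin (leaf z0) phiC rhoC n k.+2 j q.
have c0 := has_coef_sin (leaf z0) phiC rhoC n k j q.
apply: has_coef_eq (has_coef_lin (2^-1) (- 2^-1) c2 c0) => [z _|].
  have := sin_cosS k (phiC z).
  move: (sin (k.+2%:R * _)) (sin (k%:R * _)) (cos _) (sin _) => a b c d e.
  by rewrite -(subrK b a) -e; field.
rewrite !coef0 ?mulr0 ?addr0 //.
by case/orP: hjq => [->//|lt]; rewrite (ltn_trans _ lt) ?orbT.
Qed.

Lemma has_coef_cos_sin z0 n k j q : (j != n) || (k.+1 < q)%N ->
  has_coef (leaf z0) phiC rhoC
    (fun z => rhoC z ^+ n * (sin (k%:R * phiC z) * cos (phiC z))) j q 0.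
Proof.
have coef0 k' : (j != n) || (k' < q)%N -> (j == n) && (q == k') = false.
  by case: (j == n) => //= lt; rewrite gtn_eqF.
case: k => [|k] hjq.
  apply: has_coef_eq (has_coef0 _ _ _ j q) => // z _.
  by rewrite mul0r sin0 mul0r mulr0.
have c2 := has_coef_sin (leaf z0) phiC rhoC n k.+2 j q.
have c0 := has_coef_sin (leaf z0) phiC rhoC n k j q.
apply: has_coef_eq (has_coef_lin (2^-1) (2^-1) c2 c0) => [z _|].
  have := sinSS k (phiC z).
  move: (sin (k.+2%:R * _)) (sin (k.+1%:R * _)) (sin (k%:R * _)) (cos _) => a b c d e.
  by rewrite e; field.
rewrite !coef0 ?mulr0 ?addr0 //.
by case/orP: hjq => [->//|lt]; rewrite (ltn_trans _ lt) ?orbT.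
Qed.

(** A term of degree n and frequency k contributes to degree n at frequency k, and to
    degree n + 1 only at the frequencies k - 1 and k + 1. *)
Lemma has_coef_term z0 n k j q : dom A V z0 -> (maxn 1 j <= q)%N ->
  (forall k', (maxn 1 j.-1 <= k')%N -> (0 < j)%N ->
     forall z, dom A V z -> h j.-1 k' (Luv z) = 0) ->
  has_coef (leaf z0) phiC rhoC (poisson (term n k) (E0 C P m M)) j q
    (if (j == n) && (q == k) then 2 * G2 (C z0) * q%:R * h j q (Luv z0) else 0).
Proof.
move=> Dz0; rewrite geq_max => /andP[q0 jq] IH.
have [H hH] := hdep n k.
pose dH := 'D_1 (fun g => H (Lam z0) g (Theta (C z0))) (G2 (C z0)).
have dhB z : leaf z0 z -> 'd (fun y => h n k (Luv y)) z (XB z) = x1_lrl_perp m M (C z) * dH.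
  move=> [Dz L G T]; rewrite -(XhamB_u1 Dz) /dH -L -G -T.
  apply: (slice_derive_G Dz (has_diff_h n k Dz) (tangent_XhamB Dz)) => y Dy Ly Ty.
  by rewrite hH // Ly Ty.
have S_sin z : leaf z0 z -> x1_lrl_perp m M (C z) = rhoC z * sin (phiC z) / tau z0.
  move=> [Dz L G T]; rewrite sin_phiC // /tau -L -G -T -/(tau z) /rhoC.
  have r0 := lt0r_neq0 (rho_gt0 (x1_neq0 Dz)); have t0 := lt0r_neq0 (tau_gt0 Dz).
  by rewrite /Defs.rhoC; field; rewrite r0 t0.
have h0 z : leaf z0 z -> h n k (Luv z) = h n k (Luv z0).
  by move=> [Dz L G T]; rewrite !hH // L G T.
have E z : leaf z0 z -> poisson (term n k) (E0 C P m M) z =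
   2 * G2 (C z0) * k%:R * h n k (Luv z0) * (rhoC z ^+ n * sin (k%:R * phiC z))
   + (- (dH / tau z0) * (rhoC z ^+ n.+1 * (sin (phiC z) * cos (k%:R * phiC z)))
   + - (h n k (Luv z0) * k%:R * omega (Lam z0) (G2 (C z0)) (Theta (C z0))) *
     (rhoC z ^+ n.+1 * (sin (k%:R * phiC z) * cos (phiC z)))).
  move=> lz; have [Dz L G T] := lz.
  have [l hl lE] := has_diff_term n k Dz; have [dl dlE] := hl.
  rewrite poissonE // dlE lE dhB // S_sin // h0 // L G T exprS.
  move: (rhoC z) (sin _) (cos _) (dH) => a b c d.
  by move: (tau z0)^-1 => t; ring.
have [triv|ntriv] := boolP ((j == n.+1) && ((k == 0%N) && (n == 0%N) || (maxn 1 n <= k)%N)).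
  (* A term of degree j - 1 whose frequency could reach q is either that of h_00,
     which does not depend on G, or zero by the induction hypothesis. *)
  have [jn c] := andP triv; have jnn : (j == n) = false.
    by rewrite (eqP jn) gtn_eqF.
  rewrite jnn /=; apply: has_coef_eq (has_coef0 _ _ _ j q) => // z lz.
  have [Dz L G T] := lz.
  have [l hl lE] := has_diff_term n k Dz; have [dl dlE] := hl.
  rewrite poissonE // dlE lE.
  case/orP: c => [/andP[/eqP k0 /eqP n0]|kn].
    have [H0 hH0] := hdep0 0.
    have -> : 'd (fun y => h n k (Luv y)) z (XB z) = 0.
      rewrite (slice_derive_G Dz (has_diff_h n k Dz) (tangent_XhamB Dz)
        (H := fun=> H0 (Lam z) (Theta (C z)))).
        by rewrite derive_cst mulr0.
      by move=> y Dy Ly Ty; rewrite k0 n0 hH0 // Ly Ty.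
    by rewrite k0 !(mulr0, mul0r) !subr0.
  have hz y : dom A V y -> h n k (Luv y) = 0.
    by move=> Dy; have := IH k; rewrite (eqP jn) /=; apply.
  have -> : 'd (fun y => h n k (Luv y)) z (XB z) = 0.
    rewrite (slice_derive_G Dz (has_diff_h n k Dz) (tangent_XhamB Dz) (H := fun=> 0)).
      by rewrite derive_cst mulr0.
    by move=> y Dy _ _; exact: hz.
  by rewrite hz // !(mulr0, mul0r) !subr0.
have side : (j != n.+1) || (k.+1 < q)%N.
  have [jn /=|//] := eqVneq j n.+1.
  move: ntriv jq; rewrite jn eqxx /= negb_or -ltnNge => /andP[].
  case: (n) => [|n']; first by case: (k).
  by move=> _ kn nq; apply: leq_ltn_trans nq; rewrite (maxn_idPr _) in kn.
have cA := has_coefZ (2 * G2 (C z0) * k%:R * h n k (Luv z0))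
  (has_coef_sin (leaf z0) phiC rhoC n k j q).
have cB := has_coefZ (- (dH / tau z0)) (has_coef_sin_cos z0 (n := n.+1) side).
have cC := has_coefZ (- (h n k (Luv z0) * k%:R * omega (Lam z0) (G2 (C z0)) (Theta (C z0))))
  (has_coef_cos_sin z0 (n := n.+1) side).
apply: has_coef_eq (has_coefD cA (has_coefD cB cC)) => [z lz|]; first by rewrite E.
rewrite !mulr0 !addr0; case: ifP => [/andP[/eqP -> /eqP ->]|_]; first by rewrite mulr1.
by rewrite mulr0.
Qed.

Hypothesis hcomm : formally_commutes C P (dom A V) h (E0 C P m M).

(** The sine coefficient of degree j and frequency q is 2 G q h_jq by
    [has_coef_term] and the induction hypothesis, and zero by the formal
    commutation; on a leaf the two expansions have the same coefficients. *)
Lemma coefficients_vanish n k : (maxn 1 n <= k)%N ->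
  forall z, dom A V z -> h n k (Luv z) = 0.
Proof.
elim/ltn_ind: n k => j IH q hq z Dz.
have [a [b [hN h0]]] := hcomm; have [N0 hN0] := h0 j q.
pose N := maxn N0 (maxn j q).+1.
have [N1 jN qN] : [/\ (N0 <= N)%N, (j < N)%N & (q < N)%N].
  by split; rewrite /N ?leq_max ?ltnS ?leq_max ?leqnn ?orbT.
have [_ bz] := hN0 N z N1 Dz.
have q0 : (0 < q)%N by move: hq; rewrite geq_max => /andP[].
have c1 : has_coef (leaf z) phiC rhoC (poisson (partial_sum C P h N) (E0 C P m M)) j q 0.
  have [K [K0 KE]] := hN N.
  exists (fun n k => a N n k (Lam z) (G2 (C z)) (Theta (C z))).
  exists (fun n k => b N n k (Lam z) (G2 (C z)) (Theta (C z))), K; split=> // K' y KK [Dy L G T].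
  rewrite (trig_poly_widen _ _ _ KK) => [|n k nk]; last exact: K0.
  by rewrite KE // L G T.
have c2 := has_coef_sum (fun n : 'I_N => has_coef_sum (fun k : 'I_N =>
  has_coef_term n k Dz hq (fun k' hk' j0 => IH j.-1 (etrans (ltn_predL j) j0) k' hk'))).
have c3 : has_coef (leaf z) phiC rhoC (poisson (partial_sum C P h N) (E0 C P m M)) j q
    (2 * G2 (C z) * q%:R * h j q (Luv z)).
  apply: has_coef_eq c2 => [y [Dy _ _ _]|]; first by rewrite poisson_partial_sum.
  rewrite (bigD1 (Ordinal jN)) //= (bigD1 (Ordinal qN)) //= !eqxx /=.
  rewrite [X in _ + X + _]big1; last first.
    by move=> i; rewrite -val_eqE /= eq_sym => /negbTE ->.
  rewrite big1 ?addr0 // => i; rewrite -val_eqE /= eq_sym => /negbTE e.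
  by rewrite big1 // => k _; rewrite e.
have /eqP := leaf_coef_uniq Dz q0 c3 c1.
by rewrite !mulf_eq0 !pnatr_eq0 (gt_eqF (G2_gt0 (hC2 Dz))) (gtn_eqF q0) /= => /eqP.
Qed.

End Expansion.
End KeplerMap.

Theorem theorem3 (R : realType) (m2 M2 : R) (hm2 : 0 < m2) (hM2 : 0 < M2)
  (A : set R) (V : set (uv R)) (C : coords R -> phase R)
  (hC : partial_kepler_map m2 M2 A V C)
  (hu1 : forall z, dom A V z -> z.2.1 0 0 = G2 (C z))
  (P : phase R -> 'rV[R]_3)
  (hP : forall z, dom A V z -> perihelion_direction m2 M2 (C z) (P (C z)))
  (hx1C2 : forall z, dom A V z -> cross (x1 (C z)) (C2 (C z)) != 0)
  (hC2P : forall z, dom A V z -> cross (C2 (C z)) (P (C z)) != 0)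
  (hC2 : forall z, dom A V z -> C2 (C z) != 0)
  (h : nat -> nat -> R * uv R -> R)
  (hdiff : forall n m z, dom A V z -> differentiable (h n m) (Luv z))
  (hdep : forall n m, exists H : R -> R -> R -> R, forall z, dom A V z ->
     h n m (Luv z) = H (Lam z) (G2 (C z)) (Theta (C z)))
  (hdep0 : forall m, exists H : R -> R -> R, forall z, dom A V z ->
     h 0%N m (Luv z) = H (Lam z) (Theta (C z)))
  (hcomm : formally_commutes C P (dom A V) h (E0 C P m2 M2)) :
  (forall n m : nat, (maxn 1 n <= m)%N ->
     forall z, dom A V z -> h n m (Luv z) = 0) /\
  ((forall n m : nat, (1 <= n)%N -> odd `|n%:Z - m%:Z|%N ->
      forall z, dom A V z -> h n m (Luv z) = 0) ->
   forall n m : nat, (1 <= n)%N -> (n - 1 <= m)%N ->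
     forall z, dom A V z -> h n m (Luv z) = 0).
Proof.
have vanish := coefficients_vanish hm2 hM2 hC hu1 hx1C2 hC2 hP hC2P hdiff hdep hdep0 hcomm.
split=> [//|parity n m n1 nm z Dz].
have [nlem|mltn] := leqP n m; first by apply: vanish => //; rewrite geq_max (leq_trans n1).
have -> : n = m.+1 by apply/eqP; rewrite eqn_leq mltn -add1n -leq_subLR nm.
apply: parity => //.
by have -> : m.+1%:Z - m%:Z = 1 by rewrite -addn1 PoszD addrC addKr.
Qed.
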